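(* Let $A,B$ be bounded self-adjoint operators on a complex Hilbert space $H$ with spectra in an interval $J\subseteq\mathbb{R}$, let $f$ be a continuous operator convex function on $J$, and let $k,p$ be positive integers. Then $$\begin{aligned} f\left(\frac{A+B}{2}\right)&\le\frac{1}{k^p}\sum_{i=0}^{k^p-1}f\left(\frac{2i+1}{2k^p}A+\left(1-\frac{2i+1}{2k^p}\right)B\right)\\ &\le\int_0^1 f(tA+(1-t)B)\,dt\\ &\le\frac{1}{2k^p}\sum_{i=0}^{k^p-1}\left[f\left(\frac{i+1}{k^p}A+\left(1-\frac{i+1}{k^p}\right)B\right)+f\left(\frac{i}{k^p}A+\left(1-\frac{i}{k^p}\right)B\right)\right]\\ &\le\frac{f(A)+f(B)}{2}.\end{aligned}$$
   Context: $f(A)$ is defined by the continuous functional calculus. For bounded self-adjoint operators $A,B$ on a Hilbert space, $A\le B$ means $\langle (B-A)\xi,\xi\rangle\ge 0$ for every vector $\xi$. A real-valued function $f$ on an interval $J$ is operator convex if $f(\lambda A+(1-\lambda)B)\le\lambda f(A)+(1-\lambda)f(B)$ for all bounded self-adjoint operators $A,B$ on a complex Hilbert space with spectra in $J$ and all $\lambda\in[0,1]$. *)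

(* Defs.v *)
From HB Require Import structures.
From mathcomp Require Import all_boot all_order all_algebra.
From mathcomp Require Import complex.
From mathcomp Require Import all_classical all_reals all_analysis.

Set Implicit Arguments.
Unset Strict Implicit.
Unset Printing Implicit Defensive.

Import Order.TTheory GRing.Theory Num.Theory.
Import numFieldNormedType.Exports.

Local Open Scope classical_set_scope.
Local Open Scope complex_scope.
Local Open Scope ring_scope.

(* Complex Hilbert spaces.  The inner product is linear in its first argument
   and antilinear in its second one; the norm of a normed module over [R[i]]
   takes its values in the nonnegative reals of [R[i]]. *)
HB.mixin Record CompleteNormedModule_isHilbert (R : realType) (H : Type)
    of CompleteNormedModule R[i] H := {
  inner : {dot H for Num.conj};
  sqr_norm_inner : forall x : H, `|x| ^+ 2 = inner x x
}.

#[short(type="hilbertType")]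
HB.structure Definition Hilbert (R : realType) :=
  {H of CompleteNormedModule R[i] H & CompleteNormedModule_isHilbert R H}.

Section Operators.
Context {R : realType} {H : hilbertType R}.
Implicit Types S T A B : H -> H.

Definition bounded_operator T : Prop :=
  linear T /\ exists M : R, forall x, `|T x| <= M%:C * `|x|.

Definition is_adjoint T S : Prop :=
  forall x y, inner (T x) y = inner x (S y).

Definition self_adjoint T : Prop := bounded_operator T /\ is_adjoint T T.

(* On [R[i]], [0 <= z] says that [z] is real and nonnegative. *)
Definition op_le S T : Prop := forall x, 0 <= inner ((T - S) x) x.

(* Meaningful for bounded operators only: the supremum of an unbounded set of
   reals is 0 by convention. *)
Definition op_norm T : R :=
  sup [set complex.Re `|T x| | x in [set x : H | `|x| <= 1]].

Definition op_invertible T : Prop :=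
  exists S, [/\ bounded_operator S, S \o T = id & T \o S = id].

Definition spectrum T : set R[i] :=
  [set l | ~ op_invertible (l *: (id : H -> H) - T)].

(* [C(spectrum A)] is represented by the functions on [R[i]] whose restriction
   to the spectrum is continuous; [fc_isometry] makes [Phi g] depend on this
   restriction only. The alias [R[i]^o] carries the topology of [R[i]]. *)
Definition continuous_on_spectrum A (g : R[i] -> R[i]) : Prop :=
  {within (spectrum A : set R[i]^o), continuous (g : R[i]^o -> R[i]^o)}.

(* Isometric unital *-homomorphism from [C(spectrum A)] to the bounded
   operators, mapping the identity function to [A]. *)
Record is_functional_calculus A (Phi : (R[i] -> R[i]) -> (H -> H)) : Prop := {
  fc_bounded : forall g, continuous_on_spectrum A g ->
    bounded_operator (Phi g);
  fc_linear : forall (a : R[i]) g h,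
    continuous_on_spectrum A g -> continuous_on_spectrum A h ->
    Phi (fun z => a * g z + h z) = a *: Phi g + Phi h;
  fc_mul : forall g h,
    continuous_on_spectrum A g -> continuous_on_spectrum A h ->
    Phi (fun z => g z * h z) = Phi g \o Phi h;
  fc_adjoint : forall g, continuous_on_spectrum A g ->
    is_adjoint (Phi g) (Phi (fun z => Num.conj (g z)));
  fc_one : Phi (fun=> 1) = id;
  fc_id : Phi id = A;
  fc_isometry : forall g, continuous_on_spectrum A g ->
    op_norm (Phi g) = sup [set complex.Re `|g l| | l in spectrum A]
}.

(* For self-adjoint [A] such a homomorphism exists, and its values on
   [C(spectrum A)] are unique; the default value is irrelevant. *)
Definition functional_calculus A : (R[i] -> R[i]) -> (H -> H) :=
  xget (fun=> 0) [set Phi | is_functional_calculus A Phi].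

(* [f(A)] for self-adjoint [A] and [f] real-valued: the spectrum of [A] is
   real, so precomposing with the real part does not alter [f] there. *)
Definition cfc (f : R -> R) A : H -> H :=
  functional_calculus A (fun z => (f (complex.Re z))%:C).

(* The Riemann integral in operator norm: limit of the sums over the tagged
   partitions [a = s 0 <= ... <= s n = b] as the mesh tends to 0. *)
Definition is_op_integral (a b : R) (F : R -> H -> H) T : Prop :=
  [/\ forall t, a <= t <= b -> bounded_operator (F t),
      bounded_operator T
    & forall e : R, 0 < e -> exists2 d : R, 0 < d &
        forall (n : nat) (s xi : nat -> R),
          s 0%N = a -> s n = b ->
          (forall i, (i < n)%N -> s i <= xi i <= s i.+1) ->
          (forall i, (i < n)%N -> s i.+1 - s i < d) ->
          op_norm (\sum_(i < n) (s i.+1 - s i)%:C *: F (xi i) - T) < e].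

(* Unspecified when the integral does not exist; it does exist whenever [F] is
   continuous for the operator norm. *)
Definition op_integral (a b : R) (F : R -> H -> H) : H -> H :=
  xget 0 [set T | is_op_integral a b F T].

Definition op_conv (t : R) A B : H -> H := t%:C *: A + (1 - t)%:C *: B.

Definition spectrum_in A (J : set R) : Prop :=
  spectrum A `<=` [set r%:C | r in J].

End Operators.

Definition operator_convex {R : realType} (J : set R) (f : R -> R) : Prop :=
  forall (H : hilbertType R) (A B : H -> H) (t : R),
    self_adjoint A -> self_adjoint B ->
    spectrum_in A J -> spectrum_in B J -> 0 <= t <= 1 ->
    op_le (cfc f (op_conv t A B)) (op_conv t (cfc f A) (cfc f B)).

(* Main.v *)
(* Operator convexity makes [t |-> <f(tA + (1-t)B) x, x>] a convex real function
   for every vector [x], and the inequalities reduce to the classical ones for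
   midpoint and trapezoidal sums, obtained by pairing the nodes [t] and [1 - t].
   What remains is the existence of the functional calculus and of the integral.
   The former comes from approximating a continuous function uniformly on the
   spectrum by polynomials, [||p(A)||] being the maximum of [|p|] there.  For
   the latter, the numerical range of [tA + (1-t)B] lies in the hull of the
   spectra of [A] and [B]; approximating [f] by polynomials on that segment
   yields, uniformly in [t], operator polynomials in [t], whose Riemann sums
   converge in norm. *)
Require Import Defs.
From mathcomp Require Import all_boot all_order all_algebra.
From mathcomp Require Import complex.
From mathcomp Require Import all_classical all_reals all_analysis.
From mathcomp Require Import ring lra.

Set Implicit Arguments.
Unset Strict Implicit.
Unset Printing Implicit Defensive.

Import Order.TTheory GRing.Theory Num.Theory.
Import numFieldNormedType.Exports.
Local Open Scope classical_set_scope.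
Local Open Scope complex_scope.
Local Open Scope ring_scope.

(** * Norms over [R[i]] as real numbers *)

Section ComplexNorm.
Context {R : realType}.

(** [functional_calculus] and [op_integral] select with [xget], so nothing is known of them until an
    object meeting their specification has been built; this is why a statement about order calls for
    spectral theory. Most spectral facts rest on quadratic forms: a coercive form gives
    invertibility, and an invertible positive operator has a coercive form, so that the extremal
    values of a form are points of the spectrum. The scalar integral of [t |-> ri (fc t x) x] is
    never formed. A midpoint sum with [N * n] nodes splits into [N] midpoint sums with [n] nodes,
    one for each cell; convexity puts each of them between [n] times the value at the centre of the
    cell and [n] times the mean of its end values. As [n] grows, the same sums, divided by their
    number of nodes, tend to the operator integral, which gives both inequalities next to it. The
    zero space is set apart: its spectra are empty, so they yield no points of [J]. *)

Definition nrm {V : normedZmodType R[i]} (x : V) : R := complex.Re `|x|.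

Section Generic.
Context {V : normedZmodType R[i]}.
Implicit Types x y : V.

Lemma nrmE x : `|x| = (nrm x)%:C.
Proof. by rewrite /nrm RRe_real // ger0_real. Qed.

Lemma nrm_ge0 x : 0 <= nrm x.
Proof. by rewrite -ler0c -nrmE. Qed.

Lemma nrm0 : nrm (0 : V) = 0.
Proof. by rewrite /nrm normr0. Qed.

Lemma nrm_eq0 x : (nrm x == 0) = (x == 0).
Proof. by rewrite -(normr_eq0 x) nrmE eq_complex /= eqxx andbT. Qed.

Lemma nrm_gt0 x : (0 < nrm x) = (x != 0).
Proof. by rewrite lt_neqAle nrm_ge0 andbT eq_sym nrm_eq0. Qed.

Lemma nrmN x : nrm (- x) = nrm x.
Proof. by rewrite /nrm normrN. Qed.

Lemma nrmB x y : nrm (x - y) = nrm (y - x).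
Proof. by rewrite /nrm distrC. Qed.

Lemma nrmD x y : nrm (x + y) <= nrm x + nrm y.
Proof. by have := ler_normD x y; rewrite !nrmE -rmorphD lecR. Qed.

End Generic.

Lemma nrmM (a b : R[i]) : nrm (a * b) = nrm a * nrm b.
Proof. by apply: complexI; rewrite rmorphM /= -!nrmE normrM. Qed.

Lemma nrm1 : nrm (1 : R[i]) = 1.
Proof. by rewrite /nrm normr1. Qed.

Lemma nrmR (r : R) : nrm r%:C = `|r|.
Proof. by rewrite /nrm normc_def /= expr0n addr0 sqrtr_sqr. Qed.

Lemma nrm_conj (z : R[i]) : nrm (Num.conj z) = nrm z.
Proof. by rewrite /nrm norm_conjC. Qed.

Lemma nrm_sqr (z : R[i]) : nrm z ^+ 2 = complex.Re z ^+ 2 + complex.Im z ^+ 2.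
Proof. by apply: complexI; rewrite rmorphXn /= -nrmE add_Re2_Im2. Qed.

Lemma nrm_ge_Re (z : R[i]) : `|complex.Re z| <= nrm z.
Proof. by have := normc_ge_Re z; rewrite nrmE lecR. Qed.

Lemma nrm_ge_Im (z : R[i]) : `|complex.Im z| <= nrm z.
Proof.
rewrite -(@ler_pXn2r _ 2) ?nnegrE ?nrm_ge0 //.
by rewrite nrm_sqr real_normK ?num_real // lerDr sqr_ge0.
Qed.

Lemma nrm_le_ReIm (z : R[i]) : nrm z <= `|complex.Re z| + `|complex.Im z|.
Proof.
rewrite -(@ler_pXn2r _ 2) ?nnegrE ?nrm_ge0 ?addr_ge0 //.
rewrite nrm_sqr sqrrD !real_normK ?num_real // lerD2r lerDl.
by rewrite mulrn_wge0 ?mulr_ge0.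
Qed.

Lemma conjcE (z : R[i]) : Num.conj z = conjc z.
Proof. by []. Qed.

End ComplexNorm.

(** * Inner product, operator bounds and completeness *)

Section Hilbert.
Context {R : realType} {H : hilbertType R}.
Implicit Types (x y z : H) (a b : R[i]) (S T : H -> H).

Lemma nrmZ a x : nrm (a *: x) = nrm a * nrm x.
Proof. by apply: complexI; rewrite rmorphM /= -!nrmE normrZ. Qed.

Lemma nrmZR (r : R) x : nrm (r%:C *: x) = `|r| * nrm x.
Proof. by rewrite nrmZ nrmR. Qed.

Lemma innerC x y : inner x y = Num.conj (inner y x).
Proof. by rewrite (hermC (@inner R H)) expr0 mul1r. Qed.

Lemma innerDl x y z : inner (x + y) z = inner x z + inner y z.
Proof. exact: linearDl. Qed.
Lemma innerDr x y z : inner x (y + z) = inner x y + inner x z.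
Proof. exact: linearDr. Qed.
Lemma innerBl x y z : inner (x - y) z = inner x z - inner y z.
Proof. exact: linearBl. Qed.
Lemma innerBr x y z : inner x (y - z) = inner x y - inner x z.
Proof. exact: linearBr. Qed.
Lemma inner0l z : inner 0 z = 0.
Proof. exact: linear0l. Qed.
Lemma innerZl a x z : inner (a *: x) z = a * inner x z.
Proof. exact: (linearZl_LR (@inner R H)). Qed.
Lemma innerZr a x z : inner x (a *: z) = Num.conj a * inner x z.
Proof. exact: (linearZr_LR (@inner R H)). Qed.

(** The inner product of the underlying real space. It determines the order between self-adjoint
    operators, whose forms [inner (A x) x] are real. *)
Definition ri x y : R := complex.Re (inner x y).

Lemma ReDc (u v : R[i]) : complex.Re (u + v) = complex.Re u + complex.Re v.
Proof. by case: u; case: v. Qed.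
Lemma ReBc (u v : R[i]) : complex.Re (u - v) = complex.Re u - complex.Re v.
Proof. by case: u; case: v. Qed.
Lemma ReZc (r : R) (v : R[i]) : complex.Re (r%:C * v) = r * complex.Re v.
Proof. by case: v => c d /=; rewrite mul0r subr0. Qed.
Lemma ImBc (u v : R[i]) : complex.Im (u - v) = complex.Im u - complex.Im v.
Proof. by case: u; case: v. Qed.

Lemma riC x y : ri x y = ri y x.
Proof. by rewrite /ri innerC conjcE; case: (inner y x). Qed.
Lemma riDl x y z : ri (x + y) z = ri x z + ri y z.
Proof. by rewrite /ri innerDl ReDc. Qed.
Lemma riBl x y z : ri (x - y) z = ri x z - ri y z.
Proof. by rewrite /ri innerBl ReBc. Qed.
Lemma riBr x y z : ri x (y - z) = ri x y - ri x z.
Proof. by rewrite riC riBl !(riC x). Qed.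
Lemma riZl (r : R) x z : ri (r%:C *: x) z = r * ri x z.
Proof. by rewrite /ri innerZl ReZc. Qed.
Lemma riZr (r : R) x z : ri x (r%:C *: z) = r * ri x z.
Proof. by rewrite riC riZl riC. Qed.

Lemma ri_nrm x : ri x x = nrm x ^+ 2.
Proof.
apply: complexI; rewrite rmorphXn /= -nrmE sqr_norm_inner /ri -sqr_norm_inner.
by rewrite RRe_real // ger0_real // exprn_ge0.
Qed.

(** With [u = nrm x] and [v = nrm y], the squared norm of [v x - u y] equals [2 u v (u v - ri x y)],
    and [2 u v] is positive for nonzero vectors. *)
Lemma cauchy_schwarz x y : ri x y <= nrm x * nrm y.
Proof.
have [->|y0] := eqVneq y 0.
  by rewrite riC /ri inner0l nrm0 mulr0.
have := nrm_gt0 y; rewrite y0 => ny0.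
have [->|x0] := eqVneq x 0; first by rewrite /ri inner0l nrm0 mul0r.
have := nrm_gt0 x; rewrite x0 => nx0.
have := sqr_ge0 (nrm ((nrm y)%:C *: x - (nrm x)%:C *: y)).
rewrite -ri_nrm riBl !riBr !riZl !riZr !ri_nrm (riC y x).
set u := nrm x in nx0 *; set v := nrm y in ny0 *; set w := ri x y.
have -> : v * (v * u ^+ 2) - v * (u * w) - (u * (v * w) - u * (u * v ^+ 2)) =
  2 * (u * v) * (u * v - w) by ring.
by rewrite pmulr_rge0 ?subr_ge0 // mulr_gt0 // mulr_gt0.
Qed.

Lemma cauchy_schwarz_abs x y : `|ri x y| <= nrm x * nrm y.
Proof.
rewrite ler_norml cauchy_schwarz andbT lerNl.
have -> : - ri x y = ri (- x) y by rewrite -[- x]sub0r riBl /ri inner0l sub0r.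
by rewrite (le_trans (cauchy_schwarz _ _)) // nrmN.
Qed.

Lemma Im_inner x y : complex.Im (inner x y) = - ri ('i%C *: x) y.
Proof. by rewrite /ri innerZl; case: (inner x y) => c d /=; lra. Qed.

(** A bound without a supremum: it is meaningful for functions not yet known to be bounded, where
    [op_norm] may take a default value, and it passes to limits. *)
Definition bnd (M : R) T := forall x, nrm (T x) <= M * nrm x.

Lemma bounded_operatorP T :
  bounded_operator T <-> linear T /\ exists2 M, 0 <= M & bnd M T.
Proof.
split=> [[linT [M MT]]|[linT [M _ MT]]]; split=> //.
  exists `|M| => // x; have := MT x.
  rewrite !nrmE -rmorphM /= lecR => /le_trans; apply.
  by rewrite ler_wpM2r ?nrm_ge0 // ler_norm.
by exists M => x; rewrite !nrmE -rmorphM /= lecR.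
Qed.

Section LinearFacts.
Variable T : H -> H.
Hypothesis linT : linear T.
Lemma linD x y : T (x + y) = T x + T y.
Proof. by have := linT 1 x y; rewrite !scale1r. Qed.
Lemma lin0 : T 0 = 0.
Proof. by have /eqP := linD 0 0; rewrite addr0 addrC -subr_eq subrr => /eqP. Qed.
Lemma linZ a x : T (a *: x) = a *: T x.
Proof. by have := linT a x 0; rewrite lin0 !addr0. Qed.
Lemma linN x : T (- x) = - T x.
Proof. by rewrite -scaleN1r linZ scaleN1r. Qed.
Lemma linB x y : T (x - y) = T x - T y.
Proof. by rewrite linD linN. Qed.
Lemma lin_sum n (F : nat -> H) : T (\sum_(i < n) F i) = \sum_(i < n) T (F i).
Proof.
elim: n => [|n IH]; first by rewrite !big_ord0 lin0.
by rewrite !big_ord_recr /= linD IH.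
Qed.
End LinearFacts.

Lemma op_norm_ub T : bounded_operator T -> bnd (op_norm T) T.
Proof.
move=> /bounded_operatorP[linT [M M0 MT]] x.
have [->|x0] := eqVneq x 0; first by rewrite lin0 // nrm0 mulr0.
have nx : 0 < nrm x by rewrite nrm_gt0.
suff : nrm (T ((nrm x)^-1%:C *: x)) <= op_norm T.
  by rewrite linZ // nrmZR ger0_norm ?invr_ge0 ?nrm_ge0 // ler_pdivrMl // mulrC.
apply: ub_le_sup.
  exists M => _ [y y1 <-]; rewrite (le_trans (MT y)) // ler_piMr //.
  by move: y1; rewrite /= nrmE -[1]/(1%:C) lecR.
exists ((nrm x)^-1%:C *: x) => //=.
by rewrite nrmE nrmZR ger0_norm ?invr_ge0 ?nrm_ge0 // mulVf ?gt_eqF.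
Qed.

Lemma op_norm_le M T : 0 <= M -> bnd M T -> op_norm T <= M.
Proof.
move=> M0 MT; apply: ge_sup.
  by exists (nrm (T 0)); exists 0 => //=; rewrite normr0.
move=> _ [y y1 <-]; rewrite (le_trans (MT y)) // ler_piMr //.
by move: y1; rewrite /= nrmE -[1]/(1%:C) lecR.
Qed.

Lemma op_norm_ge0 T : 0 <= op_norm T.
Proof.
have [h|h] := pselect (has_sup [set complex.Re `|T x| | x in [set x : H | `|x| <= 1]]).
  rewrite (le_trans (nrm_ge0 (T 0))) //; apply: ub_le_sup; first by case: h.
  by exists 0 => //=; rewrite normr0.
(* Without a supremum, [op_norm T] is the default value 0. *)
by rewrite /op_norm sup_out.
Qed.

Lemma bnd_le M N T : M <= N -> bnd M T -> bnd N T.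
Proof. by move=> MN h x; rewrite (le_trans (h x)) // ler_wpM2r ?nrm_ge0. Qed.
Lemma bndD M N S T : bnd M S -> bnd N T -> bnd (M + N) (S + T).
Proof. by move=> hS hT x; rewrite (le_trans (nrmD _ _)) // mulrDl lerD. Qed.
Lemma bndN M S : bnd M S -> bnd M (- S).
Proof. by move=> hS x; rewrite nrmN. Qed.
Lemma bndB M N S T : bnd M S -> bnd N T -> bnd (M + N) (S - T).
Proof. by move=> hS /bndN; apply: bndD. Qed.
Lemma bndZ M a S : bnd M S -> bnd (nrm a * M) (a *: S).
Proof. by move=> hS x; rewrite nrmZ -mulrA ler_wpM2l ?nrm_ge0. Qed.
Lemma bnd_comp M N S T : 0 <= M -> bnd M S -> bnd N T -> bnd (M * N) (S \o T).
Proof.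
by move=> M0 hS hT x; rewrite (le_trans (hS _)) // -mulrA ler_wpM2l.
Qed.
Lemma bnd0 : bnd 0 (0 : H -> H).
Proof. by move=> x; rewrite nrm0 mul0r. Qed.

Lemma bounded0 : bounded_operator (0 : H -> H).
Proof.
apply/bounded_operatorP; split; last by exists 0 => //; exact: bnd0.
by move=> a x y; rewrite /= scaler0 addr0.
Qed.
Lemma bounded_id : bounded_operator (id : H -> H).
Proof.
apply/bounded_operatorP; split; last by exists 1 => // x; rewrite mul1r.
by [].
Qed.
Lemma boundedD S T : bounded_operator S -> bounded_operator T ->
  bounded_operator (S + T).
Proof.
move=> /bounded_operatorP[linS [M M0 hM]] /bounded_operatorP[linT [N N0 hN]].
apply/bounded_operatorP; split.
  by move=> a x y; rewrite !fctE linS linT scalerDr addrACA.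
by exists (M + N); [exact: addr_ge0|exact: bndD].
Qed.
Lemma boundedZ a S : bounded_operator S -> bounded_operator (a *: S).
Proof.
move=> /bounded_operatorP[linS [M M0 hM]].
apply/bounded_operatorP; split.
  by move=> b x y; rewrite !fctE linS scalerDr !scalerA (mulrC a).
by exists (nrm a * M); [rewrite mulr_ge0 ?nrm_ge0|exact: bndZ].
Qed.
Lemma boundedN S : bounded_operator S -> bounded_operator (- S).
Proof. by rewrite -scaleN1r; exact: boundedZ. Qed.
Lemma boundedB S T : bounded_operator S -> bounded_operator T ->
  bounded_operator (S - T).
Proof. by move=> bS bT; apply: boundedD => //; exact: boundedN. Qed.
Lemma bounded_comp S T : bounded_operator S -> bounded_operator T ->
  bounded_operator (S \o T).
Proof.
move=> /bounded_operatorP[linS [M M0 hM]] /bounded_operatorP[linT [N N0 hN]].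
apply/bounded_operatorP; split; first by move=> a x y; rewrite /= linT linS.
by exists (M * N); [exact: mulr_ge0|exact: bnd_comp].
Qed.

Lemma complete_nrm (u : nat -> H) :
  (forall e : R, 0 < e -> exists N, forall m n, (N <= m)%N -> (N <= n)%N ->
     nrm (u m - u n) <= e) ->
  exists l, forall e : R, 0 < e -> exists N, forall n, (N <= n)%N ->
     nrm (u n - l) <= e.
Proof.
move=> cu.
have : cauchy (u @ \oo).
  apply/cauchyP => /= e; rewrite ltcE /= => /andP[/eqP ie re].
  have ee : e = (complex.Re e)%:C by case: e ie {re} => ? ? /= ->.
  (* Half of the tolerance turns the large inequality into the strict one that a ball requires. *)
  have [|N hN] := cu (complex.Re e / 2); first by rewrite divr_gt0.
  exists (u N); exists N => // n /= Nn.
  rewrite -ball_normE /= nrmE ee ltcR (le_lt_trans (hN _ _ _ _)) //.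
  by rewrite ltr_pdivrMr // ltr_pMr // ltr1n.
move/cauchy_cvg/cvg_ex => [l /cvgrPdist_le /= ul].
exists l => e e0; have [|N _ hN] := ul e%:C; first by rewrite ltcR.
by exists N => n Nn; have := hN n Nn; rewrite /= distrC nrmE lecR.
Qed.

End Hilbert.

(** * Criteria for invertibility *)

Section Invertibility.
Context {R : realType} {H : hilbertType R}.
Implicit Types (x y z : H) (a b : R[i]) (S T E : H -> H).

Lemma expr_small (q e : R) : 0 <= q < 1 -> 0 < e ->
  exists N, forall n, (N <= n)%N -> q ^+ n <= e.
Proof.
move=> /andP[q0 q1] e0.
have := @cvg_expr R q; rewrite ger0_norm // => /(_ q1).
move=> /cvgrPdist_le /(_ e e0) [N _ hN]; exists N => n Nn.
by have := hN n Nn; rewrite /= sub0r normrN ger0_norm // exprn_ge0.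
Qed.

Lemma nrm_le_eps_eq0 x : (forall e : R, 0 < e -> nrm x <= e) -> x = 0.
Proof.
move=> h; apply/eqP; rewrite -nrm_eq0 eq_le nrm_ge0 andbT.
by apply/ler_addgt0Pr => e /h; rewrite add0r.
Qed.

(** The lower bound serves twice: it makes [T] injective, so that any choice of preimages is a
    linear two-sided inverse, and it bounds this inverse by [c^-1]. *)
Lemma bounded_below_surj_invertible T (c : R) : bounded_operator T -> 0 < c ->
  (forall x, c * nrm x <= nrm (T x)) -> (forall y, exists x, T x = y) ->
  op_invertible T.
Proof.
move=> /bounded_operatorP[linT _] c0 hT /choice[S TS].
have injT x y : T x = T y -> x = y.
  move=> xy; apply/eqP; rewrite -subr_eq0 -nrm_eq0 eq_le nrm_ge0 andbT.
  by rewrite -(pmulr_rle0 _ c0) (le_trans (hT _)) // linB // xy subrr nrm0.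
exists S; split.
- apply/bounded_operatorP; split.
    by move=> a x y; apply: injT; rewrite linT !TS.
  exists c^-1; first by rewrite invr_ge0 ltW.
  by move=> x; rewrite -ler_pdivrMl ?invr_gt0 // invrK -[in leRHS](TS x).
- by apply/funext => x; apply: injT; rewrite /= TS.
- by apply/funext => x; rewrite /= TS.
Qed.

(** Solving [x - E x = y] is a fixed point problem for the contraction [x |-> E x + y]; its iterates
    from 0 are the partial sums of the Neumann series applied to [y]. *)
Lemma neumann E (q : R) : bounded_operator E -> 0 <= q < 1 -> bnd q E ->
  op_invertible (id - E).
Proof.
move=> bE /[dup] q01 /andP[q0 q1] hE.
have [linE _] := bE.
have q1' : 0 < 1 - q by rewrite subr_gt0.
apply: (@bounded_below_surj_invertible _ (1 - q)) => //.
- by apply: boundedB => //; exact: bounded_id.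
- move=> x; rewrite !fctE mulrBl mul1r lerBlDr.
  rewrite (le_trans _ (lerD (lexx _) (hE x))) //.
  by rewrite -[in leLHS](subrK (E x) x) nrmD.
move=> y; pose u n := iter n (fun x => E x + y) 0.
(* The fixed point of [r |-> q r + nrm y], hence a bound that the iteration preserves. *)
pose C := nrm y / (1 - q).
have C0 : 0 <= C by rewrite divr_ge0 ?nrm_ge0 // ltW.
have uC n : nrm (u n) <= C.
  elim: n => [|n IH]; first by rewrite nrm0.
  rewrite (le_trans (nrmD _ _)) // (le_trans (lerD (hE _) (lexx _))) //.
  rewrite (le_trans (lerD (ler_wpM2l q0 IH) (lexx _))) //.
  by rewrite /C le_eqVlt; apply/orP; left; apply/eqP; field; rewrite gt_eqF.
have du n k : nrm (u (n + k)%N - u n) <= q ^+ n * C.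
  elim: n => [|n IH]; first by rewrite add0n subr0 expr0 mul1r.
  have -> : u (n.+1 + k)%N - u n.+1 = E (u (n + k)%N - u n).
    by rewrite linB // addSn /u !iterS opprD addrACA subrr addr0.
  rewrite (le_trans (hE _)) //.
  by rewrite exprS -mulrA ler_wpM2l.
have [e e0|l ul] := @complete_nrm R H u.
  have C1 : 0 < C + 1 by rewrite ltr_wpDl.
  have [|N hN] := @expr_small q (e / 2 / (C + 1)) q01.
    by rewrite !divr_gt0.
  have duN m : (N <= m)%N -> nrm (u m - u N) <= e / 2.
    move=> Nm; rewrite -(subnKC Nm) (le_trans (du _ _)) //.
    rewrite (le_trans (ler_wpM2r C0 (hN N (leqnn _)))) //.
    rewrite mulrAC ler_pdivrMr // ler_pM2l ?divr_gt0 //.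
    by rewrite lerDl.
  exists N => m n Nm Nn; rewrite -(subrKA (u N)) (le_trans (nrmD _ _)) //.
  by rewrite [leRHS]splitr lerD ?duN // nrmB duN.
exists l; apply/eqP; rewrite -subr_eq0; apply/eqP/nrm_le_eps_eq0 => e e0.
have [|N hN] := ul (e / 2); first by rewrite divr_gt0.
have -> : (id - E) l - y = (l - u N.+1) + E (u N - l).
  rewrite [u N.+1]iterS -/(u N) linB // !fctE opprD [l + (_ - y)]addrA.
  by rewrite [RHS]addrAC subrKA.
rewrite (le_trans (nrmD _ _)) // [leRHS]splitr lerD //.
  by rewrite nrmB hN.
rewrite (le_trans (hE _)) // (le_trans _ (hN N (leqnn _))) //.
by rewrite ler_piMl ?nrm_ge0 // ltW.
Qed.

Lemma invertibleZ a T : bounded_operator T -> a != 0 ->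
  op_invertible (a *: T) -> op_invertible T.
Proof.
move=> [linT _] a0 [S [bS ST TS]]; exists (a *: S); split.
- exact: boundedZ.
- rewrite -ST; apply/funext => x /=; rewrite [in RHS]fctE [in RHS]linZ //.
  by case: bS.
- by rewrite -TS; apply/funext => x; rewrite /= !fctE linZ.
Qed.

Lemma invertible_comp S T : op_invertible S -> op_invertible T ->
  op_invertible (S \o T).
Proof.
move=> [S' [bS' S'S SS']] [T' [bT' T'T TT']]; exists (T' \o S'); split.
- exact: bounded_comp.
- rewrite -[RHS]T'T; apply/funext => x /=; congr T'.
  exact: (congr1 (@^~ (T x)) S'S).
- rewrite -[RHS]SS'; apply/funext => x /=; congr S.
  exact: (congr1 (@^~ (S' x)) TT').
Qed.

Lemma invertible_bounded_below T : op_invertible T ->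
  exists2 c : R, 0 < c & forall x, c * nrm x <= nrm (T x).
Proof.
move=> [S [/bounded_operatorP[_ [M M0 hM]] ST _]].
have M1 : 0 < M + 1 by rewrite ltr_wpDl.
exists (M + 1)^-1 => [|x]; first by rewrite invr_gt0.
have STx : S (T x) = x := congr1 (@^~ x) ST.
rewrite ler_pdivrMl // -[in leLHS]STx.
by rewrite (le_trans (hM _)) // ler_wpM2r ?nrm_ge0 // lerDl.
Qed.

(* Lax-Milgram: [id - e T] is a contraction for small [e > 0]. *)
Lemma coercive_invertible T (c : R) : bounded_operator T -> 0 < c ->
  (forall x, c * nrm x ^+ 2 <= ri (T x) x) -> op_invertible T.
Proof.
move=> bT c0 hT; have [linT [M M0 hM]] := (bounded_operatorP T).1 bT.
(* The square of the norm of [x - e T x] is at most [1 - 2 e c + e^2 K^2] times that of [x]. The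
   value [e = c / K^2] minimises this factor and makes it [1 - e c], which is nonnegative because
   [c <= K]. *)
pose K := M + c; have K0 : 0 < K by rewrite ltr_wpDl.
pose e := c / K ^+ 2; have e0 : 0 < e by rewrite divr_gt0 // exprn_gt0.
have hq : 0 <= 1 - e * c < 1.
  rewrite subr_ge0 gtrBl mulr_gt0 // andbT /e mulrAC ler_pdivrMr ?exprn_gt0 //.
  by rewrite mul1r -expr2 ler_pXn2r ?nnegrE ?(ltW K0) ?(ltW c0) // lerDr.
have /andP[hq0 hq1] := hq.
apply: (@invertibleZ e%:C) => //.
  by rewrite eq_complex /= eqxx andbT gt_eqF.
suff : op_invertible (id - (id - e%:C *: T)) by rewrite opprB addrC subrK.
apply: (@neumann _ (Num.sqrt (1 - e * c))).
- by apply: boundedB; [exact: bounded_id|exact: boundedZ].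
- by rewrite sqrtr_ge0 -[ltRHS]sqrtr1 ltr_sqrt.
move=> x; rewrite -(@ler_pXn2r _ 2) ?nnegrE ?nrm_ge0 ?mulr_ge0 ?sqrtr_ge0 ?nrm_ge0 //.
rewrite exprMn sqr_sqrtr // -ri_nrm !fctE.
rewrite riBl !riBr !riZl !riZr !ri_nrm (riC x).
have hTx := hT x.
have hTM : nrm (T x) ^+ 2 <= K ^+ 2 * nrm x ^+ 2.
  rewrite -exprMn ler_pXn2r ?nnegrE ?mulr_ge0 ?nrm_ge0 ?(ltW K0) //.
  by rewrite (le_trans (hM _)) // ler_wpM2r ?nrm_ge0 // lerDl ltW.
have h1 : e * (c * nrm x ^+ 2) <= e * ri (T x) x by rewrite ler_pM2l.
have h2 : e * (e * nrm (T x) ^+ 2) <= e * (c * nrm x ^+ 2).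
  rewrite ler_pM2l // (le_trans (ler_wpM2l (ltW e0) hTM)) // mulrA.
  by rewrite /e divfK // expf_neq0 // gt_eqF.
lra.
Qed.

End Invertibility.

(** * Adjoints and self-adjoint operators *)

Section Adjoints.
Context {R : realType} {H : hilbertType R}.
Implicit Types (x y z : H) (a b : R[i]) (S T A P : H -> H).

Lemma adjoint_id : is_adjoint (id : H -> H) id.
Proof. by []. Qed.

Lemma adjoint0 : is_adjoint (0 : H -> H) 0.
Proof. move=> x y; have -> : (0 : H -> H) x = 0 by [].
by have -> : (0 : H -> H) y = 0; rewrite // inner0l innerC inner0l rmorph0. Qed.

Lemma adjointD S S' T T' : is_adjoint S S' -> is_adjoint T T' ->
  is_adjoint (S + T) (S' + T').
Proof. by move=> hS hT x y; rewrite !fctE innerDl innerDr hS hT. Qed.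

Lemma adjointZ a S S' : is_adjoint S S' -> is_adjoint (a *: S) (Num.conj a *: S').
Proof. by move=> hS x y; rewrite !fctE innerZl innerZr hS conjCK. Qed.

Lemma adjoint_comp S S' T T' : is_adjoint S S' -> is_adjoint T T' ->
  is_adjoint (S \o T) (T' \o S').
Proof. by move=> hS hT x y; rewrite /= hS hT. Qed.

Lemma adjointC S T : is_adjoint S T -> is_adjoint T S.
Proof. by move=> h x y; rewrite innerC -h -innerC. Qed.

Lemma conjR (r : R) : Num.conj (r%:C) = r%:C.
Proof. exact: conjc_real. Qed.

Lemma sa_id : self_adjoint (id : H -> H).
Proof. by split; [exact: bounded_id|exact: adjoint_id]. Qed.

Lemma saD S T : self_adjoint S -> self_adjoint T -> self_adjoint (S + T).
Proof. by move=> [? ?] [? ?]; split; [exact: boundedD|exact: adjointD]. Qed.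

Lemma saZ (r : R) S : self_adjoint S -> self_adjoint (r%:C *: S).
Proof.
move=> [bS aS]; split; first exact: boundedZ.
by have := @adjointZ r%:C _ _ aS; rewrite conjR.
Qed.

Lemma saN S : self_adjoint S -> self_adjoint (- S).
Proof.
move=> [bS aS]; split; first exact: boundedN.
by have := @adjointZ (-1) _ _ aS; rewrite rmorphN rmorph1 !scaleN1r.
Qed.

Lemma saB S T : self_adjoint S -> self_adjoint T -> self_adjoint (S - T).
Proof. by move=> ? ?; apply: saD => //; exact: saN. Qed.

Lemma saM T T' : bounded_operator T -> bounded_operator T' -> is_adjoint T T' ->
  self_adjoint (T' \o T).
Proof.
move=> bT bT' h; split; first exact: bounded_comp.
by apply: adjoint_comp => //; exact: adjointC.
Qed.

Lemma sa_inner A x : self_adjoint A -> inner (A x) x = (ri (A x) x)%:C.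
Proof.
move=> [_ aA]; have : inner (A x) x = Num.conj (inner (A x) x).
  by rewrite -innerC aA.
rewrite /ri conjcE; case: (inner _ _) => c d /= [dN].
by apply/eqP; rewrite eq_complex /= eqxx /=; apply/eqP; lra.
Qed.

Lemma inner_nrm x : inner x x = (nrm x ^+ 2)%:C.
Proof. by rewrite (@sa_inner id) ?ri_nrm //; exact: sa_id. Qed.

End Adjoints.

(** * Quadratic forms and the spectrum *)

Section Spectrum.
Context {R : realType} {H : hilbertType R}.
Implicit Types (x y z : H) (l : R[i]) (S T A B P : H -> H).

Definition op_lower (a : R) A := forall x, a * nrm x ^+ 2 <= ri (A x) x.
Definition op_upper (b : R) A := forall x, ri (A x) x <= b * nrm x ^+ 2.

Lemma bounded_resolvent l A : bounded_operator A ->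
  bounded_operator (l *: (id : H -> H) - A).
Proof. by move=> bA; apply: boundedB => //; apply: boundedZ; exact: bounded_id. Qed.

(** Outside the segment a multiple of [l - A] is coercive. For [l = u + iv] with [v] nonzero the
    factor is [-iv]: the form of [A] being real, what remains of the real part is [v^2]. For real
    [l] the factor is -1 on the left of [a] and 1 on the right of [b]. *)
Lemma spectrum_sub_bounds A (a b : R) : self_adjoint A ->
  op_lower a A -> op_upper b A ->
  spectrum A `<=` [set r%:C | r in `[a, b]].
Proof.
move=> sA lA uA [u v] /= nI; have [bA _] := sA.
have [v0|v0] := eqVneq v 0; last first.
  exfalso; apply: nI; apply: (@invertibleZ _ _ (Complex 0 (- v))).
  - exact: bounded_resolvent.
  - by rewrite eq_complex /= eqxx /= oppr_eq0.
  - apply: (@coercive_invertible _ _ _ (v ^+ 2)).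
    + by apply: boundedZ; exact: bounded_resolvent.
    + by rewrite exprn_even_gt0.
    + move=> x; rewrite /ri !fctE innerZl innerBl innerZl sa_inner // inner_nrm /=.
      by rewrite expr2; lra.
subst v; exists u => //=; rewrite in_itv /=; apply/negP => /negP.
rewrite negb_and -!ltNge => /orP[ua|bu]; apply: nI.
- apply: (@invertibleZ _ _ (-1)); first exact: bounded_resolvent.
    by rewrite oppr_eq0 oner_eq0.
  apply: (@coercive_invertible _ _ _ (a - u)); rewrite ?subr_gt0 //.
    by apply: boundedZ; exact: bounded_resolvent.
  move=> x; rewrite scaleN1r opprB !fctE riBl riZl ri_nrm.
  by have := lA x; lra.
- apply: (@coercive_invertible _ _ _ (u - b)); rewrite ?subr_gt0 //.
    exact: bounded_resolvent.
  move=> x; rewrite !fctE riBl riZl ri_nrm.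
  by have := uA x; lra.
Qed.

(** When [b] bounds [P], positivity at the vector [x - b^-1 P x] yields
    [nrm (P x) ^+ 2 <= b * ri (P x) x], without a square root of [P]. Invertibility bounds
    [nrm (P x)] from below, hence also the form. *)
Lemma positive_invertible_lower P : self_adjoint P -> op_lower 0 P ->
  op_invertible P -> exists2 c : R, 0 < c & op_lower c P.
Proof.
move=> sP lP /invertible_bounded_below[c c0 hc].
have [/bounded_operatorP[linP [M M0 hM]] aP] := sP.
pose b := M + 1; have b0 : 0 < b by rewrite ltr_wpDl.
have key x : nrm (P x) ^+ 2 <= b * ri (P x) x.
  have := lP (x - b^-1%:C *: P x); rewrite mul0r linB // linZ //.
  rewrite riBl !riBr !riZl !riZr ri_nrm.
  have -> : ri (P (P x)) x = nrm (P x) ^+ 2 by rewrite /ri aP -/(ri _ _) ri_nrm.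
  have h1 : ri (P (P x)) (P x) <= b * nrm (P x) ^+ 2.
    rewrite (le_trans (cauchy_schwarz _ _)) // expr2 mulrA ler_wpM2r ?nrm_ge0 //.
    by rewrite (le_trans (hM _)) // ler_wpM2r ?nrm_ge0 // lerDl.
  have h2 : b^-1 * ri (P (P x)) (P x) <= nrm (P x) ^+ 2 by rewrite ler_pdivrMl.
  have h3 : b^-1 * (b^-1 * ri (P (P x)) (P x)) <= b^-1 * nrm (P x) ^+ 2.
    by rewrite ler_pM2l // invr_gt0.
  by move=> h; rewrite -ler_pdivrMl //; lra.
exists (c ^+ 2 / b); first by rewrite divr_gt0 // exprn_gt0.
move=> x; rewrite mulrAC ler_pdivrMr // mulrC [leRHS]mulrC.
rewrite (le_trans _ (key x)) // mulrC -exprMn ler_pXn2r ?nnegrE ?nrm_ge0 //.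
by rewrite mulr_ge0 ?nrm_ge0 // ltW.
Qed.

Lemma nontrivial_unit : (exists x : H, x != 0) -> exists x : H, nrm x = 1.
Proof.
move=> [x x0]; have n0 : 0 < nrm x by rewrite nrm_gt0.
exists ((nrm x)^-1%:C *: x).
by rewrite nrmZR ger0_norm ?invr_ge0 ?nrm_ge0 // mulVf ?gt_eqF.
Qed.

(** The witness is the infimum of the form on the unit sphere. Were [A] minus this infimum
    invertible, its form would be bounded below by some [c > 0], and the infimum could be raised by
    [c]. *)
Lemma spectrum_lower A : self_adjoint A -> (exists x : H, x != 0) ->
  exists a : R, spectrum A a%:C /\ op_lower a A.
Proof.
move=> sA /nontrivial_unit[x1 nx1].
have [/[dup] bA /bounded_operatorP[linA [M M0 hM]] _] := sA.
pose E := [set ri (A x) x | x in [set x : H | nrm x = 1]].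
have E0 : E !=set0 by exists (ri (A x1) x1), x1.
have lE : has_lbound E.
  exists (- M) => _ [x /= x_1 <-]; have := cauchy_schwarz_abs (A x) x.
  rewrite x_1 mulr1 ler_norml => /andP[h _]; rewrite (le_trans _ h) // lerN2.
  by rewrite (le_trans (hM x)) // x_1 mulr1.
have lo a : lbound E a -> op_lower a A.
  move=> Ea x; have [->|x0] := eqVneq x 0.
    by rewrite nrm0 expr0n mulr0 lin0 // /ri inner0l.
  have nx : 0 < nrm x by rewrite nrm_gt0.
  have := Ea _ (ex_intro2 _ _ ((nrm x)^-1%:C *: x) _ erefl).
  rewrite linZ // riZl riZr ler_pdivlMl // ler_pdivlMl // => h.
  rewrite mulrC expr2 -mulrA; apply: h.
  by rewrite /= nrmZR ger0_norm ?invr_ge0 ?nrm_ge0 // mulVf ?gt_eqF.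
exists (inf E); have lA : op_lower (inf E) A by apply: lo; exact: ge_inf.
split=> // inv.
have [|||c c0 hc] := @positive_invertible_lower (A - (inf E)%:C *: id).
- by apply: saB => //; apply: saZ; exact: sa_id.
- by move=> x; rewrite mul0r !fctE riBl riZl ri_nrm subr_ge0.
- apply: (@invertibleZ _ _ (-1)); last by rewrite scaleN1r opprB.
    by apply: boundedB => //; apply: boundedZ; exact: bounded_id.
  by rewrite oppr_eq0 oner_eq0.
have : inf E + c <= inf E.
  apply: lb_le_inf => // _ [x /= x_1 <-].
  have := hc x; rewrite !fctE riBl riZl ri_nrm x_1 expr1n; lra.
by rewrite gerDl leNgt c0.
Qed.

Lemma spectrumN A l : bounded_operator A -> spectrum (- A) l -> spectrum A (- l).
Proof.
move=> bA nI inv; apply: nI; apply: (@invertibleZ _ _ (-1)).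
- by apply: bounded_resolvent; exact: boundedN.
- by rewrite oppr_eq0 oner_eq0.
- by move: inv; rewrite scaleN1r opprD opprK scaleNr.
Qed.

Lemma spectrum_upper A : self_adjoint A -> (exists x : H, x != 0) ->
  exists b : R, spectrum A b%:C /\ op_upper b A.
Proof.
move=> sA x1; have [a [sa la]] := spectrum_lower (saN sA) x1.
exists (- a); split.
  by rewrite rmorphN; apply: spectrumN => //; case: sA.
move=> x; have := la x; rewrite !fctE -sub0r riBl /ri inner0l /=; lra.
Qed.

(** The operator [op_norm T ^+ 2 - T' T] is positive. If it were invertible, its form would be at
    least some [c > 0], and [op_norm T ^+ 2] could be lowered by [c]. *)
Lemma op_norm_sqr_spectrum T T' : bounded_operator T -> bounded_operator T' ->
  is_adjoint T T' -> (exists x : H, x != 0) ->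
  spectrum (T' \o T) (op_norm T ^+ 2)%:C.
Proof.
move=> bT bT' hT /nontrivial_unit[x1 nx1] inv.
have riT x : ri ((T' \o T) x) x = nrm (T x) ^+ 2.
  by rewrite /= riC /ri -hT -/(ri _ _) ri_nrm.
have [||c c0 hc] := positive_invertible_lower _ _ inv.
- by apply: saB; [apply: saZ; exact: sa_id|exact: saM].
- move=> x; rewrite mul0r !fctE riBl riZl ri_nrm -/((T' \o T) x) riT subr_ge0.
  by rewrite -exprMn ler_pXn2r ?nnegrE ?mulr_ge0 ?nrm_ge0 ?op_norm_ge0 //; exact: op_norm_ub.
have hc' x : nrm (T x) ^+ 2 <= (op_norm T ^+ 2 - c) * nrm x ^+ 2.
  by have := hc x; rewrite !fctE riBl riZl ri_nrm -/((T' \o T) x) riT; lra.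
have d0 : 0 <= op_norm T ^+ 2 - c.
  by have := hc' x1; rewrite nx1 expr1n mulr1; apply: le_trans; exact: sqr_ge0.
have : op_norm T <= Num.sqrt (op_norm T ^+ 2 - c).
  apply: op_norm_le; first exact: sqrtr_ge0.
  move=> x; rewrite -(@ler_pXn2r _ 2) ?nnegrE ?nrm_ge0 ?mulr_ge0 ?sqrtr_ge0 ?nrm_ge0 //.
  by rewrite exprMn sqr_sqrtr.
rewrite -(@ler_pXn2r _ 2) ?nnegrE ?op_norm_ge0 ?sqrtr_ge0 // sqr_sqrtr //.
by rewrite lerDl oppr_ge0 leNgt c0.
Qed.

Lemma spectrum_bounded A l : bounded_operator A -> spectrum A l ->
  nrm l <= op_norm A.
Proof.
move=> bA sl; rewrite leNgt; apply/negP => lt; apply: sl.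
have l0 : l != 0 by rewrite -nrm_gt0 (le_lt_trans (op_norm_ge0 A)).
have nl0 : 0 < nrm l by rewrite nrm_gt0.
have il0 : l^-1 != 0 by rewrite invr_eq0.
apply: (@invertibleZ _ _ l^-1) => //; first exact: bounded_resolvent.
rewrite scalerBr scalerA mulVf // scale1r.
have nV : nrm l^-1 = (nrm l)^-1.
  by apply: (mulfI (lt0r_neq0 nl0)); rewrite -nrmM !mulfV ?nrm1 // lt0r_neq0.
apply: (@neumann _ _ _ (nrm l^-1 * op_norm A)); first exact: boundedZ.
  rewrite mulr_ge0 ?nrm_ge0 ?op_norm_ge0 //= nV.
  by rewrite ltr_pdivrMl // mulr1.
by apply: bndZ; exact: op_norm_ub.
Qed.

(** With [S] the inverse of [l - A], one has [m - A = (l - A) (id - (l - m) S)], and the second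
    factor is invertible by the Neumann series for [m] close to [l]. *)
Lemma resolvent_open A l : bounded_operator A -> ~ spectrum A l ->
  exists2 e : R, 0 < e & forall m, nrm (m - l) < e -> ~ spectrum A m.
Proof.
move=> bA /contrapT [S [bS SA AS]].
have [linS _] := bS.
have s0 : 0 < op_norm S + 1 by rewrite ltr_wpDl ?op_norm_ge0.
exists (op_norm S + 1)^-1; first by rewrite invr_gt0.
move=> m ml; apply; have -> : m *: (id : H -> H) - A =
    (l *: (id : H -> H) - A) \o (id - (l - m) *: S).
  apply/funext => x; rewrite [RHS]/=.
  have [linR _] := bounded_resolvent l bA.
  rewrite linB // -[((l - m) *: S) x]/((l - m) *: S x) linZ //.
  rewrite -[(l *: id - A) (S x)]/(((l *: id - A) \o S) x) AS.
  by rewrite !fctE /= scalerBl opprB [RHS]addrC subrKA.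
apply: invertible_comp; first by exists S.
apply: (@neumann _ _ _ (nrm (l - m) * op_norm S)); first exact: boundedZ.
  rewrite mulr_ge0 ?nrm_ge0 ?op_norm_ge0 //= nrmB.
  rewrite (@le_lt_trans _ _ (nrm (m - l) * (op_norm S + 1))) //.
    by rewrite ler_wpM2l ?nrm_ge0 // lerDl.
  by rewrite -ltr_pdivlMr // div1r.
by apply: bndZ; exact: op_norm_ub.
Qed.

Lemma spectrum_compact A : bounded_operator A ->
  compact [set r : R | spectrum A r%:C].
Proof.
move=> bA; apply: (@subclosed_compact _ _ `[- op_norm A, op_norm A]).
- rewrite -[X in closed X]setCK; apply: open_closedC.
  rewrite openE => r /= nr; have [e e0 he] := resolvent_open bA nr.
  apply/nbhs_ballP; exists e => //= s; rewrite -ball_normE /= => rs.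
  by apply: he; rewrite -rmorphB nrmR distrC.
- exact: segment_compact.
- move=> r /= /(spectrum_bounded bA).
  by rewrite nrmR in_itv /= ler_norml.
Qed.

End Spectrum.

(** * Polynomials of an operator *)

Section Polynomials.
Context {R : realType} {H : hilbertType R}.
Implicit Types (x y z : H) (l c : R[i]) (S T A B P : H -> H) (p q : {poly R[i]}).

(** An explicit sum, since arbitrary functions [H -> H] do not form a ring under composition;
    multiplicativity holds for linear [A] only. *)
Definition peval A p : H -> H := fun x => \sum_(i < size p) p`_i *: iter i A x.

Lemma peval_wide A p n x : (size p <= n)%N ->
  peval A p x = \sum_(i < n) p`_i *: iter i A x.
Proof.
move=> pn; rewrite /peval (big_ord_widen n (fun i => p`_i *: iter i A x) pn).
rewrite big_mkcond /=; apply: eq_bigr => i _; case: ltnP => // ip.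
by rewrite nth_default // scale0r.
Qed.

Lemma peval_linear A c p q :
  peval A (c *: p + q) = c *: peval A p + peval A q.
Proof.
apply/funext => x; rewrite !fctE.
pose n := maxn (size (c *: p + q)) (maxn (size p) (size q)).
rewrite !(@peval_wide _ _ n) ?leq_max ?leqnn ?orbT //.
rewrite scaler_sumr -big_split; apply: eq_bigr => i _ /=.
by rewrite coefD coefZ scalerDl scalerA.
Qed.

Lemma peval0 A : peval A 0 = 0.
Proof. by apply/funext => x; rewrite /peval size_poly0 big_ord0. Qed.

Lemma pevalD A p q : peval A (p + q) = peval A p + peval A q.
Proof. by rewrite -[p]scale1r peval_linear !scale1r. Qed.

Lemma pevalZ A c p : peval A (c *: p) = c *: peval A p.
Proof. by rewrite -[c *: p]addr0 peval_linear peval0 addr0. Qed.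

Lemma pevalB A p q : peval A (p - q) = peval A p - peval A q.
Proof. by rewrite -scaleN1r addrC peval_linear scaleN1r addrC. Qed.

Lemma pevalC A c : peval A c%:P = c *: id.
Proof.
apply/funext => x; rewrite (@peval_wide _ _ 1) ?size_polyC_leq1 //.
by rewrite big_ord_recl big_ord0 addr0 coefC.
Qed.

Lemma pevalMX A p : linear A -> peval A (p * 'X) = A \o peval A p.
Proof.
move=> linA; apply/funext => x.
rewrite (@peval_wide _ _ (size p).+1); last first.
  by rewrite (leq_trans (size_polyMleq _ _)) // size_polyX addn2.
rewrite big_ord_recl coefMX scale0r add0r /= /peval (lin_sum linA _ (fun i => p`_i *: iter i A x)).
by apply: eq_bigr => i _; rewrite coefMX /= linZ.
Qed.

Lemma pevalX A : linear A -> peval A 'X = A.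
Proof. by move=> linA; rewrite -['X]mul1r pevalMX // pevalC scale1r. Qed.

Lemma pevalM A p q : linear A -> peval A (p * q) = peval A p \o peval A q.
Proof.
move=> linA; elim/poly_ind: p => [|p c IH]; first by rewrite mul0r peval0.
rewrite mulrDl mulrAC mul_polyC pevalD pevalMX // IH pevalZ pevalD pevalMX //.
by rewrite pevalC.
Qed.

Lemma peval_bounded A p : bounded_operator A -> bounded_operator (peval A p).
Proof.
move=> bA; have [linA _] := bA.
elim/poly_ind: p => [|p c IH]; first by rewrite peval0; exact: bounded0.
rewrite pevalD pevalMX // pevalC; apply: boundedD.
  exact: bounded_comp.
by apply: boundedZ; exact: bounded_id.
Qed.

Lemma peval_comm A p : linear A -> A \o peval A p = peval A p \o A.
Proof. by move=> linA; rewrite -pevalMX // pevalM // pevalX. Qed.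

Lemma peval_adjoint A p : self_adjoint A ->
  is_adjoint (peval A p) (peval A (map_poly Num.conj p)).
Proof.
move=> [[linA _] aA]; elim/poly_ind: p => [|p c IH].
  by rewrite map_poly0 peval0; exact: adjoint0.
rewrite rmorphD rmorphM /= map_polyX map_polyC /= !pevalD !pevalMX // !pevalC.
apply: adjointD.
  by rewrite [X in is_adjoint _ X]peval_comm //; exact: adjoint_comp.
by apply: adjointZ; exact: adjoint_id.
Qed.

(** Over the algebraically closed field [R[i]], [p(A)] is a scalar times a product of factors
    [A - z] with [z] a root; if no root lay in the spectrum, every factor would be invertible. *)
Lemma peval_spectrum_root A p : bounded_operator A -> p != 0 ->
  ~ op_invertible (peval A p) -> exists2 l, root p l & spectrum A l.
Proof.
move=> bA p0 nI; apply: contrapT => nex; apply: nI.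
have [linA _] := bA.
have [r pE] := closed_field_poly_normal p.
have rs (z : R[i]) : z \in r -> ~ spectrum A z.
  move=> zr sz; apply: nex; exists z => //.
  by rewrite pE rootZ ?lead_coef_eq0 // root_prod_XsubC.
have lp : (lead_coef p)^-1 != 0 by rewrite invr_eq0 lead_coef_eq0.
apply: (@invertibleZ _ _ (lead_coef p)^-1) => //; first exact: peval_bounded.
rewrite -pevalZ {2}pE scalerA mulVf ?lead_coef_eq0 // scale1r.
elim: r rs {pE} => [|z r IH] rs.
  by rewrite big_nil pevalC scale1r; exists id; split=> //; exact: bounded_id.
rewrite big_cons pevalM //; apply: invertible_comp; last first.
  by apply: IH => y yr; apply: rs; rewrite in_cons yr orbT.
apply: (@invertibleZ _ _ (-1)); first exact: peval_bounded.
  by rewrite oppr_eq0 oner_eq0.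
rewrite pevalB pevalX // pevalC scaleN1r opprB.
by apply: contrapT => h; apply: (rs z) => //; rewrite mem_head.
Qed.

(** If [U] inverts [S T = T S], then [S U] is a right inverse of [T] and [U S] a left inverse, so
    the two coincide. *)
Lemma invertible_commuting S T : bounded_operator S -> bounded_operator T ->
  S \o T = T \o S -> op_invertible (S \o T) -> op_invertible T.
Proof.
move=> bS bT ST [U [bU US SU]].
have TSU x : T (S (U x)) = x.
  by have := congr1 (@^~ x) SU; rewrite ST.
have UST x : U (S (T x)) = x := congr1 (@^~ x) US.
exists (S \o U); split; first exact: bounded_comp.
- apply/funext => x /=; rewrite -[RHS]UST -[in RHS](TSU (T x)).
  by have /= -> := congr1 (@^~ (S (U (T x)))) US.
- by apply/funext => x /=; rewrite TSU.
Qed.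

(** One inclusion of the spectral mapping theorem: ['X - l] divides [p.[l] - p], so invertibility of
    [p.[l] - p(A)] would pass to the commuting factor [A - l]. *)
Lemma spectrum_peval A p l : bounded_operator A -> spectrum A l ->
  spectrum (peval A p) p.[l].
Proof.
move=> bA sl inv; apply: sl; have [linA _] := bA.
have /factor_theorem [q qE] : root (p.[l]%:P - p) l.
  by rewrite rootE hornerD hornerN hornerC subrr.
apply: (@invertibleZ _ _ (-1)); first exact: bounded_resolvent.
  by rewrite oppr_eq0 oner_eq0.
have -> : -1 *: (l *: (id : H -> H) - A) = peval A ('X - l%:P).
  by rewrite pevalB pevalX // pevalC scaleN1r opprB.
apply: (@invertible_commuting (peval A q)); try exact: peval_bounded.
  by rewrite -!pevalM // mulrC.
by rewrite -pevalM // -qE pevalB pevalC.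
Qed.

Lemma horner_norm_le A p l : bounded_operator A -> spectrum A l ->
  nrm p.[l] <= op_norm (peval A p).
Proof.
by move=> bA sl; apply: spectrum_bounded; [exact: peval_bounded|exact: spectrum_peval].
Qed.

Lemma sa_spectrum_real A l : self_adjoint A -> spectrum A l ->
  l = (complex.Re l)%:C.
Proof.
move=> sA sl; have [bA _] := sA; have ub := op_norm_ub bA.
have cs x : `|ri (A x) x| <= op_norm A * nrm x ^+ 2.
  rewrite (le_trans (cauchy_schwarz_abs _ _)) // expr2 mulrA.
  by rewrite ler_wpM2r ?nrm_ge0.
have [||r _ <- //] := @spectrum_sub_bounds _ _ A (- op_norm A) (op_norm A) sA _ _ _ sl.
  by move=> x; have := cs x; rewrite mulNr ler_norml => /andP[].
by move=> x; have := cs x; rewrite ler_norml => /andP[].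
Qed.

(* The C*-identity [||T||^2 = ||T^* T||] reduces the norm of [p(A)] to the
   spectrum of the positive operator [p(A)^* p(A)], which contains [||T||^2]. *)
Lemma op_norm_peval A p : self_adjoint A -> (exists x : H, x != 0) ->
  exists2 l, spectrum A l & op_norm (peval A p) = nrm p.[l].
Proof.
move=> sA x1; have [bA _] := sA; have [linA _] := bA.
pose p' := map_poly Num.conj p.
(* The spectrum is real, so conjugate coefficients give conjugate values on it. *)
have nE l : spectrum A l -> (p' * p).[l] = (nrm p.[l] ^+ 2)%:C.
  move=> sl; rewrite hornerM rmorphXn /= -nrmE.
  have -> : p'.[l] = Num.conj p.[l].
    by rewrite (sa_spectrum_real sA sl) -[in LHS](conjR (complex.Re l)) horner_map.
  by rewrite normCK mulrC.
have := @op_norm_sqr_spectrum _ _ (peval A p) (peval A p')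
  (peval_bounded _ bA) (peval_bounded _ bA) (peval_adjoint _ sA) x1.
set mu := op_norm _; rewrite -pevalM // => smu.
suff [l sl h] : exists2 l, spectrum A l & (p' * p).[l] = (mu ^+ 2)%:C.
  exists l => //; move: h; rewrite nE // => /complexI/eqP.
  by rewrite eqrXn2 ?nrm_ge0 ?op_norm_ge0 // => /eqP ->.
(* The root argument asks for a nonzero polynomial. If this one vanishes, [p' * p] is the constant
   [mu ^+ 2], and any point of the spectrum will do. *)
have [e0|n0] := eqVneq ((mu ^+ 2)%:C%:P - p' * p) 0.
  have [a [sa _]] := spectrum_lower sA x1; exists a%:C => //.
  by move/eqP: e0; rewrite subr_eq0 => /eqP <-; rewrite hornerC.
have [|l /rootP rl sl] := peval_spectrum_root bA n0.
  by rewrite pevalB pevalC.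
exists l => //; move/eqP: rl; rewrite hornerD hornerN hornerC subr_eq0.
by move/eqP.
Qed.

Lemma op_norm_peval_le A p (e : R) : self_adjoint A -> 0 <= e ->
  (forall l, spectrum A l -> nrm p.[l] <= e) -> bnd e (peval A p).
Proof.
move=> sA e0 he x; have [bA _] := sA.
have [->|x0] := eqVneq x 0.
  by rewrite lin0 ?nrm0 ?mulr0 //; case: (peval_bounded p bA).
have [|l sl nl] := op_norm_peval p sA; first by exists x.
rewrite (le_trans (op_norm_ub (peval_bounded p bA) x)) //.
by rewrite ler_wpM2r ?nrm_ge0 // nl he.
Qed.

End Polynomials.

(** * Bernstein polynomials and Weierstrass approximation *)

Section Weierstrass.
Context {R : realType}.
Implicit Types (F : R -> R) (x y e : R).

(* The Bernstein polynomial [\sum_k 'C(n, k) phi k x^k (1 - x)^(n - k)], by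
   Pascal's rule. *)
Fixpoint bernstein (n : nat) (phi : nat -> R) : {poly R} :=
  if n is n'.+1 then
    'X * bernstein n' (fun k => phi k.+1) + (1 - 'X) * bernstein n' phi
  else (phi 0%N)%:P.

Lemma bernsteinS n phi x : (bernstein n.+1 phi).[x] =
  x * (bernstein n (fun k => phi k.+1)).[x] + (1 - x) * (bernstein n phi).[x].
Proof. by rewrite /= !hornerE. Qed.

Lemma bernstein_le n (phi psi : nat -> R) x : 0 <= x <= 1 ->
  (forall k, (k <= n)%N -> phi k <= psi k) ->
  (bernstein n phi).[x] <= (bernstein n psi).[x].
Proof.
move=> /andP[x0 x1]; elim: n phi psi => [|n IH] phi psi h.
  by rewrite /= !hornerC h.
rewrite !bernsteinS lerD // ler_wpM2l ?subr_ge0 //; apply: IH => k kn; apply: h => //.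
by rewrite (leq_trans kn).
Qed.

Lemma bernstein_affine n (a b : R) phi x :
  (bernstein n (fun k => a + b * phi k)).[x] = a + b * (bernstein n phi).[x].
Proof.
elim: n phi => [|n IH] phi; first by rewrite /= !hornerC.
by rewrite !bernsteinS !IH; ring.
Qed.

(** The second moment of a binomial law about [a]. The centre is arbitrary because the induction
    shifts it to [a - 1]; the application takes [a = n x], which leaves the variance. *)
Lemma bernstein_variance n (a : R) x :
  (bernstein n (fun k => (k%:R - a) ^+ 2)).[x] =
  n%:R * x * (1 - x) + (n%:R * x - a) ^+ 2.
Proof.
elim: n a => [|n IH] a; first by rewrite /= hornerC; ring.
rewrite bernsteinS IH.
have -> : (fun k => (k.+1%:R - a) ^+ 2) = (fun k : nat => (k%:R - (a - 1)) ^+ 2 : R).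
  by apply/funext => k; rewrite -natr1; ring.
by rewrite IH -natr1; ring.
Qed.

(** On the nodes [F] lies between two quadratic functions centred at [x]. Monotonicity transfers
    this to the Bernstein polynomials, and at [x] the quadratic term becomes [C x (1 - x) / n]. *)
Lemma bernstein_approx F e (C : R) n x : (0 < n)%N -> 0 <= x <= 1 -> 0 <= C ->
  (forall y, 0 <= y <= 1 -> `|F x - F y| <= e + C * (x - y) ^+ 2) ->
  `|F x - (bernstein n (fun k => F (k%:R / n%:R))).[x]| <= e + C / n%:R.
Proof.
move=> n0 /[dup] x01 /andP[x0 x1] C0 h.
have n0' : (0 : R) < n%:R by rewrite ltr0n.
have n1 : n%:R != 0 :> R by rewrite gt_eqF.
have hk k : (k <= n)%N -> `|F x - F (k%:R / n%:R)| <=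
    e + C / n%:R ^+ 2 * (k%:R - n%:R * x) ^+ 2.
  move=> kn; have -> : e + C / n%:R ^+ 2 * (k%:R - n%:R * x) ^+ 2 =
    e + C * (x - k%:R / n%:R) ^+ 2 by field.
  apply: h; rewrite divr_ge0 ?ler0n //= ler_pdivrMr // mul1r ler_nat //.
have V : C / n%:R ^+ 2 * (n%:R * x * (1 - x)) <= C / n%:R.
  have -> : C / n%:R ^+ 2 * (n%:R * x * (1 - x)) = C / n%:R * (x * (1 - x)) by field.
  rewrite ler_piMr ?divr_ge0 ?ler0n //.
  by rewrite mulr_ile1 ?subr_ge0 // lerBlDr lerDl.
rewrite ler_norml; apply/andP; split.
- have := @bernstein_le n (fun k => F (k%:R / n%:R))
    (fun k => (F x + e) + C / n%:R ^+ 2 * (k%:R - n%:R * x) ^+ 2) x x01.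
  rewrite bernstein_affine bernstein_variance subrr expr0n addr0 => H.
  suff : (bernstein n (fun k => F (k%:R / n%:R))).[x] <= F x + e + C / n%:R by lra.
  rewrite (le_trans (H _)) ?lerD2l // => k kn.
  by have := hk k kn; rewrite ler_norml => /andP[+ _]; lra.
- have := @bernstein_le n
    (fun k => (F x - e) + (- (C / n%:R ^+ 2)) * (k%:R - n%:R * x) ^+ 2)
    (fun k => F (k%:R / n%:R)) x x01.
  rewrite bernstein_affine bernstein_variance subrr expr0n addr0 => H.
  suff : F x - e - C / n%:R <= (bernstein n (fun k => F (k%:R / n%:R))).[x] by lra.
  rewrite (le_trans _ (H _)) ?mulNr ?lerD2l ?lerN2 // => k kn.
  by have := hk k kn; rewrite ler_norml => /andP[_ +]; lra.
Qed.

(** Heine's theorem, with the right neighbourhoods of 0 as the filter of radii in the covering form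
    of compactness. *)
Lemma uniformly_continuous_segment F e : continuous F -> 0 < e ->
  exists2 d : R, 0 < d & forall x y, 0 <= x <= 1 -> `|x - y| < d ->
    `|F x - F y| <= e.
Proof.
move=> cF e0.
have := @segment_compact R 0 1; rewrite compact_near_coveringP.
pose P (d x : R) := forall y, `|x - y| < d -> `|F x - F y| <= e.
move=> /(_ R (0^'+) P _) []; last first.
  move=> d /= d0 h; exists (d / 2); first by rewrite divr_gt0.
  move=> x y x01; apply: h => //=; last first.
  - by rewrite divr_gt0.
  - by rewrite sub0r normrN gtr0_norm ?divr_gt0 // ltr_pdivrMr // ltr_pMr // ltr1n.
move=> x _; have /cvgrPdist_le /(_ (e / 2)) := cF x.
rewrite divr_gt0 // => /(_ isT) /nbhs_ballP [r /= r0 hr].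
have r2 : 0 < r / 2 by rewrite divr_gt0.
exists (ball x (r / 2), [set d : R | d < r / 2]); first split => /=.
- exact: nbhsx_ballx.
- exact: nbhs_right_lt.
move=> [x' d] [/=]; rewrite -ball_normE /= => xx' dr y x'y.
have hxx' := hr x'; have hxy := hr y.
rewrite -(subrKA (F x)) (le_trans (ler_normD _ _)) // [leRHS]splitr lerD //.
  rewrite distrC; apply: hr; rewrite -ball_normE /= (lt_trans xx') //.
  by rewrite ltr_pdivrMr // ltr_pMr // ltr1n.
apply: hr; rewrite -ball_normE /= -(subrKA x') (le_lt_trans (ler_normD _ _)) //.
by rewrite [ltRHS]splitr ltrD // (lt_trans x'y).
Qed.

Lemma weierstrass_unit F e : continuous F -> 0 < e ->
  exists p : {poly R}, forall x, 0 <= x <= 1 -> `|F x - p.[x]| <= e.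
Proof.
move=> cF e0.
have e2 : 0 < e / 2 by rewrite divr_gt0.
have [d d0 hd] := uniformly_continuous_segment cF e2.
have [|M [_ hM]] := @compact_bounded R R^o (F @` `[0, 1]).
  apply: continuous_compact; last exact: segment_compact.
  exact: continuous_subspaceT.
pose M1 := `|M| + 1.
have FM x : 0 <= x <= 1 -> `|F x| <= M1.
  move=> x01; apply: hM; first by rewrite /M1 ltr_pwDr // ler_norm.
  by exists x => //=; rewrite in_itv.
have M10 : 0 <= M1 by rewrite addr_ge0.
(* For points at distance at least [d], the crude bound [2 * M1] on the oscillation is absorbed by
   [C (x - y)^2]; closer points are handled by uniform continuity. *)
pose C := 2 * M1 / d ^+ 2.
have C0 : 0 <= C by rewrite divr_ge0 ?mulr_ge0 ?exprn_ge0 // ltW.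
have hC x y : 0 <= x <= 1 -> 0 <= y <= 1 ->
    `|F x - F y| <= e / 2 + C * (x - y) ^+ 2.
  move=> x01 y01; have [xy|xy] := ltP `|x - y| d.
    by rewrite (le_trans (hd _ _ x01 xy)) // lerDl mulr_ge0 ?sqr_ge0.
  rewrite (@le_trans _ _ (2 * M1)) //.
    by rewrite (le_trans (ler_normB _ _)) // mulr_natl mulr2n lerD ?FM.
  rewrite ler_wpDl ?(ltW e2) // /C mulrAC ler_pdivlMr ?exprn_gt0 //.
  rewrite ler_wpM2l ?mulr_ge0 // -[leRHS]real_normK ?num_real //.
  by rewrite ler_pXn2r ?nnegrE // ltW.
(* Larger than [C / (e / 2)], so that the variance term [C / n] is at most [e / 2]. *)
pose n := (Num.truncn (C / (e / 2))).+1.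
exists (bernstein n (fun k => F (k%:R / n%:R))) => x x01.
rewrite (le_trans (@bernstein_approx F (e / 2) C n x _ _ _ _)) //.
  by move=> y y01; exact: hC.
rewrite [leRHS]splitr lerD2l ler_pdivrMr ?ltr0n //.
rewrite mulrC -ler_pdivrMr //.
by rewrite ltW // truncnS_gt.
Qed.

(** A spectrum need not be a segment, so [F] is first extended from [K] to the whole line by
    Tietze's theorem. A segment [[-N, N]] containing [K] is then rescaled to [[0, 1]] by
    [x |-> (x + N) / (2 N)]. *)
Lemma weierstrass (K : set R) F e : compact K -> {within K, continuous F} ->
  0 < e -> exists p : {poly R}, forall x, K x -> `|F x - p.[x]| <= e.
Proof.
move=> cK cF e0.
have [M M0 FM] : exists2 M, 0 < M & forall x, K x -> `|F x| <= M.
  have [|M [_ hM]] := @compact_bounded R R^o (F @` K).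
    exact: continuous_compact.
  exists (`|M| + 1) => [|x Kx]; first by rewrite ltr_wpDl.
  by apply: hM; [rewrite ltr_pwDr // ler_norm|exists x].
have clK : closed K by apply: compact_closed => //; exact: Rhausdorff.
have [G [FG cG _]] := @continuous_bounded_extension R R
  (@pseudometric_normal R R) K clK F M M0 cF FM.
have [N N0 KN] : exists2 N, 0 < N & forall x, K x -> `|x| <= N.
  have [M' [_ hM']] := @compact_bounded R R^o K cK.
  exists (`|M'| + 1) => [|x Kx]; first by rewrite ltr_wpDl.
  by apply: hM' => //; rewrite ltr_pwDr // ler_norm.
have [|p hp] := @weierstrass_unit (fun t => G (N * (2 * t - 1))) e _ e0.
  move=> t; apply: continuous_comp; last exact: cG.
  apply: cvgM; first exact: cvg_cst.
  by apply: cvgB; [apply: cvgM; [exact: cvg_cst|exact: cvg_id]|exact: cvg_cst].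
exists (p \Po ((2 * N)^-1 *: ('X + N%:P))) => x Kx.
rewrite horner_comp hornerZ hornerD hornerX hornerC.
have Nn0 : N != 0 by rewrite gt_eqF.
have := hp ((2 * N)^-1 * (x + N)).
have -> : N * (2 * ((2 * N)^-1 * (x + N)) - 1) = x by field.
rewrite -(FG x) ?inE //; apply.
have := KN x Kx; rewrite ler_norml => /andP[h1 h2].
apply/andP; split.
  by rewrite mulr_ge0 ?invr_ge0 ?mulr_ge0 ?(ltW N0) //; lra.
by rewrite ler_pdivrMl ?mulr_gt0 //; lra.
Qed.

End Weierstrass.

(** * Construction of the continuous functional calculus *)

Section FunctionalCalculus.
Context {R : realType} {H : hilbertType R}.
Implicit Types (x y : H) (l : R[i]) (S T D A : H -> H) (g h : R[i] -> R[i]).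
Implicit Types (p q : {poly R[i]}).

Lemma continuous_on_spectrumP A g : continuous_on_spectrum A g <->
  forall l, spectrum A l -> forall e : R, 0 < e -> exists2 d : R, 0 < d &
    forall m, spectrum A m -> nrm (l - m) < d -> nrm (g l - g m) <= e.
Proof.
rewrite /continuous_on_spectrum subspace_continuousP; split.
- move=> cg l sl e e0; have /cvgrPdist_le /(_ e%:C) := cg l sl.
  rewrite ltcR => /(_ e0); rewrite near_withinE => /nbhs_ballP [d /=].
  rewrite ltcE /= => /andP[/eqP id rd] hd.
  have dE : d = (complex.Re d)%:C by case: d id {rd hd} => ? ? /= ->.
  exists (complex.Re d) => // m sm lm.
  have : `|g l - g m| <= e%:C.
    by apply: hd => //; rewrite -ball_normE /= nrmE dE ltcR.
  by rewrite nrmE lecR.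
- move=> cg l sl; apply/cvgrPdist_le => /= e.
  rewrite ltcE /= => /andP[/eqP ie re].
  have eE : e = (complex.Re e)%:C by case: e ie {re} => ? ? /= ->.
  have [d d0 hd] := cg l sl _ re.
  rewrite near_withinE; apply/nbhs_ballP; exists d%:C; first by rewrite /= ltcR.
  move=> m; rewrite -ball_normE /= nrmE ltcR => lm sm.
  by rewrite nrmE eE lecR hd.
Qed.

(** Real and imaginary parts of [g] are approximated separately on the real compact spectrum, each
    within [e / 2]. *)
Lemma weierstrass_spectrum A g (e : R) : self_adjoint A ->
  continuous_on_spectrum A g -> 0 < e ->
  exists p, forall l, spectrum A l -> nrm (g l - p.[l]) <= e.
Proof.
move=> sA /continuous_on_spectrumP cg e0.
have [bA _] := sA.
have cK := spectrum_compact bA; set K := [set r : R | _] in cK.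
have e2 : 0 < e / 2 by rewrite divr_gt0.
have cont (P : R[i] -> R) : (forall z, `|P z| <= nrm z) ->
    (forall z w, P (z - w) = P z - P w) ->
    {within K, continuous (fun r : R => P (g r%:C))}.
  move=> P1 PB; apply/subspace_continuousP => r Kr.
  apply/cvgrPdist_le => /= d d0; have [b b0 hb] := cg _ Kr _ d0.
  rewrite near_withinE; apply/nbhs_ballP; exists b => //= s.
  rewrite -ball_normE /= => rs Ks; rewrite -PB (le_trans (P1 _)) //.
  by apply: hb => //; rewrite -rmorphB nrmR.
have [p hp] := weierstrass cK (cont _ nrm_ge_Re ReBc) e2.
have [q hq] := weierstrass cK (cont _ nrm_ge_Im ImBc) e2.
exists (map_poly (real_complex R) p + 'i%C *: map_poly (real_complex R) q).
move=> l sl; rewrite (sa_spectrum_real sA sl); set r := complex.Re l.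
have Kr : K r by rewrite /K /= -(sa_spectrum_real sA sl).
rewrite hornerD hornerZ !horner_map /= (le_trans (nrm_le_ReIm _)) //.
rewrite [leRHS]splitr lerD //.
  have := hp r Kr; congr (`|_| <= _); case: (g _) => u v /=; ring.
have := hq r Kr; congr (`|_| <= _); case: (g _) => u v /=; ring.
Qed.

(** The graph of the functional calculus as a relation: [T] is a norm limit of [p(A)] for
    polynomials [p] tending to [g] uniformly on the spectrum. No sequence of approximants has to be
    fixed. *)
Definition fc_approx A g T := forall e : R, 0 < e -> exists2 p,
  forall l, spectrum A l -> nrm (g l - p.[l]) <= e & bnd e (T - peval A p).

Lemma bnd_eps D (M C : R) :
  (forall e : R, 0 < e -> bnd (M + C * e) D) -> bnd M D.
Proof.
move=> h x; apply/ler_addgt0Pr => e e0.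
pose c := `|C| * nrm x + 1.
have c0 : 0 < c by rewrite ltr_wpDl ?mulr_ge0 ?nrm_ge0.
rewrite (le_trans (h (e / c) _ x)) ?divr_gt0 // mulrDl lerD2l.
rewrite (@le_trans _ _ (`|C| * (e / c) * nrm x)) //.
  by rewrite ler_wpM2r ?nrm_ge0 // ler_wpM2r ?ler_norm // divr_ge0 ?ltW.
rewrite mulrAC mulrCA ler_piMr ?(ltW e0) // ler_pdivrMr // mul1r.
by rewrite /c lerDl.
Qed.

Lemma bnd0_eq D : bnd 0 D -> D = 0.
Proof.
move=> h; apply/funext => x; apply/eqP; rewrite -nrm_eq0 eq_le nrm_ge0 andbT.
by rewrite (le_trans (h x)) // mul0r.
Qed.

Lemma bounded_operator_closed T :
  (forall e : R, 0 < e -> exists2 S, bounded_operator S & bnd e (T - S)) ->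
  bounded_operator T.
Proof.
move=> hT; apply/bounded_operatorP; split.
- move=> a x y; apply/eqP; rewrite -subr_eq0; apply/eqP.
  apply: nrm_le_eps_eq0 => e e0.
  pose c := nrm (a *: x + y) + (nrm a * nrm x + nrm y) + 1.
  have c0 : 0 < c by rewrite ltr_wpDl // !addr_ge0 ?mulr_ge0 ?nrm_ge0.
  have [S [linS _] hS] := hT (e / c) (divr_gt0 e0 c0).
  have -> : T (a *: x + y) - (a *: T x + T y) =
      (T - S) (a *: x + y) - (a *: (T - S) x + (T - S) y).
    rewrite !fctE linS scalerBr (addrACA (a *: T x)).
    by rewrite -(opprD (a *: S x)) (opprB (a *: T x + T y)) subrKA.
  rewrite (le_trans (nrmD _ _)) // nrmN.
  rewrite (le_trans (lerD (hS _) (nrmD _ _))) // nrmZ.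
  rewrite (le_trans (lerD (lexx _) (lerD (ler_wpM2l (nrm_ge0 a) (hS x)) (hS y)))) //.
  rewrite mulrCA -!mulrDr mulrAC ler_pdivrMr // ler_pM2l //.
  by rewrite lerDl.
- have [S bS hS] := hT 1 ltr01.
  exists (1 + op_norm S); first by rewrite addr_ge0 ?op_norm_ge0.
  by rewrite -[T](subrK S); apply: bndD => //; exact: op_norm_ub.
Qed.

(** The limit is taken pointwise in [H]; the uniform Cauchy bound survives when one of the two
    indices tends to infinity. *)
Lemma op_complete (u : nat -> H -> H) :
  (forall e : R, 0 < e -> exists N, forall m n : nat, (N <= m)%N -> (N <= n)%N ->
    bnd e (u m - u n)) ->
  exists T, forall e : R, 0 < e -> exists N, forall n, (N <= n)%N ->
    bnd e (T - u n).
Proof.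
move=> cu.
have /choice[T hT] x : exists y, forall e : R, 0 < e -> exists N, forall n,
    (N <= n)%N -> nrm (u n x - y) <= e.
  apply: complete_nrm => e e0.
  have c0 : 0 < nrm x + 1 by rewrite ltr_wpDl ?nrm_ge0.
  have [N hN] := cu _ (divr_gt0 e0 c0); exists N => m n Nm Nn.
  rewrite (le_trans (hN m n Nm Nn x)) // mulrAC ler_pdivrMr // ler_pM2l //.
  by rewrite lerDl.
exists T => e e0; have [N hN] := cu e e0; exists N => n Nn x.
apply/ler_addgt0Pr => b b0; have [M hM] := hT x b b0.
rewrite !fctE -(subrKA (u (maxn M N) x)) (le_trans (nrmD _ _)) // addrC lerD //.
  by apply: hN => //; exact: leq_maxr.
by rewrite nrmB hM ?leq_maxl.
Qed.

(** The factor 2 comes from estimating real and imaginary parts separately; any constant suffices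
    for passing adjoints to the limit. *)
Lemma nrm_inner_le x y : nrm (inner x y) <= 2 * (nrm x * nrm y).
Proof.
rewrite (le_trans (nrm_le_ReIm _)) // mulr_natl mulr2n lerD //.
  exact: cauchy_schwarz_abs.
rewrite Im_inner normrN (le_trans (cauchy_schwarz_abs _ _)) // nrmZ.
have -> : nrm ('i%C : R[i]) = 1.
  by apply/eqP; rewrite -(@eqrXn2 _ 2) ?nrm_ge0 // nrm_sqr /= expr0n expr1n add0r.
by rewrite mul1r.
Qed.

Lemma adjoint_closed T T' :
  (forall e : R, 0 < e -> exists S S', [/\ is_adjoint S S',
    bnd e (T - S) & bnd e (T' - S')]) -> is_adjoint T T'.
Proof.
move=> hT x y; apply/eqP; rewrite -subr_eq0 -nrm_eq0 eq_le nrm_ge0 andbT.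
apply/ler_addgt0Pr => e e0; rewrite add0r.
pose c := 4 * (nrm x * nrm y) + 1.
have c0 : 0 < c by rewrite ltr_wpDl // !mulr_ge0 ?nrm_ge0.
have d0 := divr_gt0 e0 c0; set d := e / _ in d0.
have [S [S' [aS TS T'S']]] := hT d d0.
have -> : inner (T x) y - inner x (T' y) =
    inner ((T - S) x) y - inner x ((T' - S') y).
  by rewrite !fctE innerBl innerBr aS opprB addrA subrK.
rewrite (le_trans (nrmD _ _)) // nrmN.
rewrite (le_trans (lerD (nrm_inner_le _ _) (nrm_inner_le _ _))) //.
have h1 : nrm ((T - S) x) * nrm y <= d * nrm x * nrm y.
  by rewrite ler_wpM2r ?nrm_ge0.
have h2 : nrm x * nrm ((T' - S') y) <= nrm x * (d * nrm y).
  by rewrite ler_wpM2l ?nrm_ge0.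
have dc : d * c = e by rewrite /d divfK // gt_eqF.
rewrite -dc /c; lra.
Qed.

Section SelfAdjoint.
Variable A : H -> H.
Hypothesis sA : self_adjoint A.
Let bA : bounded_operator A. Proof. by case: sA. Qed.
Let linA : linear A. Proof. by case: bA. Qed.

Lemma peval_close p q (e : R) : 0 <= e ->
  (forall l, spectrum A l -> nrm (p.[l] - q.[l]) <= e) ->
  bnd e (peval A p - peval A q).
Proof.
move=> e0 h; rewrite -pevalB; apply: op_norm_peval_le => // l sl.
by rewrite hornerD hornerN h.
Qed.

(** From some approximants to all of them: two polynomials close to [g] on the spectrum are close to
    each other there, hence so are their values at [A]. Uniqueness of [T] follows. *)
Lemma fc_approx_any g T p (e : R) : fc_approx A g T -> 0 <= e ->
  (forall l, spectrum A l -> nrm (g l - p.[l]) <= e) -> bnd e (T - peval A p).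
Proof.
move=> gT e0 hp; apply: (@bnd_eps _ _ 2) => d d0.
have [q hq Tq] := gT d d0.
have pq : bnd (d + e) (peval A q - peval A p).
  apply: peval_close => [|l sl]; first by rewrite addr_ge0 // ltW.
  rewrite -(subrKA (g l)) (le_trans (nrmD _ _)) // lerD ?hp //.
  by rewrite nrmB hq.
have -> : T - peval A p = (T - peval A q) + (peval A q - peval A p).
  by rewrite addrA subrK.
by apply: bnd_le (bndD Tq pq); lra.
Qed.

Lemma fc_approx_unique g T T' : fc_approx A g T -> fc_approx A g T' -> T = T'.
Proof.
move=> gT gT'; apply/eqP; rewrite -subr_eq0; apply/eqP/bnd0_eq.
apply: (@bnd_eps _ _ 2) => e e0.
have [p hp Tp] := gT e e0.
have T'p := fc_approx_any gT' (ltW e0) hp.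
have -> : T - T' = (T - peval A p) - (T' - peval A p).
  by rewrite opprB addrA subrK.
by apply: bnd_le (bndB Tp T'p); lra.
Qed.

Lemma fc_approx_exists g : continuous_on_spectrum A g ->
  exists T, fc_approx A g T.
Proof.
move=> cg; pose d n : R := n.+1%:R^-1.
have d0 n : 0 < d n by rewrite invr_gt0 ltr0n.
have dsmall (e : R) : 0 < e -> exists N, forall n, (N <= n)%N -> d n <= e.
  move=> e0; exists (Num.truncn e^-1) => n Nn.
  rewrite -[leRHS]invrK lef_pV2 ?posrE ?ltr0n ?invr_gt0 //.
  by rewrite (le_trans (ltW (truncnS_gt _))) // ler_nat.
have /choice[p hp] n := weierstrass_spectrum sA cg (d0 n).
have [e e0|T hT] := @op_complete (fun n => peval A (p n)).
  have [N hN] := dsmall (e / 2) (divr_gt0 e0 (ltr0n _ 2)).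
  exists N => m n Nm Nn; apply: peval_close => [|l sl]; first exact: ltW.
  rewrite -(subrKA (g l)) (le_trans (nrmD _ _)) // [leRHS]splitr lerD //.
    by rewrite nrmB (le_trans (hp _ _ sl)) // hN.
  by rewrite (le_trans (hp _ _ sl)) // hN.
exists T => e e0; have [N hN] := dsmall e e0; have [M hM] := hT e e0.
exists (p (maxn M N)) => [l sl|]; last by apply: hM; exact: leq_maxl.
by rewrite (le_trans (hp _ _ sl)) // hN // leq_maxr.
Qed.

Lemma fc_approx_bounded g T : fc_approx A g T -> bounded_operator T.
Proof.
move=> gT; apply: bounded_operator_closed => e e0; have [p _ hp] := gT e e0.
by exists (peval A p) => //; exact: peval_bounded.
Qed.

Lemma fc_approx_bound g T : fc_approx A g T ->
  exists2 M : R, 0 <= M & bnd M T /\ forall l, spectrum A l -> nrm (g l) <= M.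
Proof.
move=> gT; have [p gp hp] := gT 1 ltr01.
exists (1 + op_norm (peval A p)); first by rewrite addr_ge0 ?op_norm_ge0.
split.
  rewrite -[T](subrK (peval A p)); apply: bndD => //.
  by apply: op_norm_ub; exact: peval_bounded.
move=> l sl; rewrite -(subrK p.[l] (g l)) (le_trans (nrmD _ _)) // lerD ?gp //.
exact: horner_norm_le.
Qed.

Lemma fc_approx_linear (a : R[i]) g h T T' : fc_approx A g T ->
  fc_approx A h T' -> fc_approx A (fun z => a * g z + h z) (a *: T + T').
Proof.
move=> gT hT' e e0; have c0 : 0 < nrm a + 1 by rewrite ltr_wpDl ?nrm_ge0.
have d0 := divr_gt0 e0 c0; set d := e / _ in d0.
have dE : nrm a * d + d = e.
  by rewrite -[X in _ + X]mul1r -mulrDl /d mulrC divfK // gt_eqF.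
have [p gp Tp] := gT d d0; have [q hq Tq] := hT' d d0.
exists (a *: p + q) => [l sl|].
  have -> : a * g l + h l - (a *: p + q).[l] = a * (g l - p.[l]) + (h l - q.[l]).
    by rewrite hornerD hornerZ mulrBr addrACA opprD.
  rewrite (le_trans (nrmD _ _)) // nrmM -dE lerD ?hq //.
  by rewrite ler_wpM2l ?nrm_ge0 ?gp.
rewrite peval_linear -dE.
have -> : a *: T + T' - (a *: peval A p + peval A q) =
    a *: (T - peval A p) + (T' - peval A q).
  by rewrite scalerBr addrACA opprD.
by apply: bndD => //; exact: bndZ.
Qed.

Lemma fc_approx_mul g h T T' : fc_approx A g T -> fc_approx A h T' ->
  fc_approx A (fun z => g z * h z) (T \o T').
Proof.
move=> gT hT' e e0.
have [M M0 [TM gM]] := fc_approx_bound gT.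
have [N N0 [TN hN]] := fc_approx_bound hT'.
(* The error of the product is [d N + (M + d) d], at most [d (M + N + 1)] once [d <= 1]. *)
pose c := M + N + 1; have c0 : 0 < c by rewrite ltr_wpDl // addr_ge0.
pose d := Num.min 1 (e / c).
have d0 : 0 < d by rewrite lt_min ltr01 divr_gt0.
have d1 : d <= 1 by rewrite ge_min lexx.
have de : d * c <= e by rewrite -ler_pdivlMr // ge_min lexx orbT.
have [p gp Tp] := gT d d0; have [q hq Tq] := hT' d d0.
have hbound : d * N + (M + d) * d <= e.
  apply: le_trans de; rewrite /c; nra.
exists (p * q) => [l sl|].
  have -> : g l * h l - (p * q).[l] =
      (g l - p.[l]) * h l + (g l - (g l - p.[l])) * (h l - q.[l]).
    by rewrite hornerM; ring.
  apply: le_trans hbound; rewrite (le_trans (nrmD _ _)) // !nrmM.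
  rewrite lerD // ler_pM ?nrm_ge0 ?gp ?hN ?hq //.
  by rewrite (le_trans (nrmD _ _)) // nrmN lerD ?gM ?gp.
apply: bnd_le hbound _; rewrite pevalM //.
have [linp _] := peval_bounded p bA.
have -> : (T \o T') - (peval A p \o peval A q) =
    ((T - peval A p) \o T') + ((T - (T - peval A p)) \o (T' - peval A q)).
  rewrite subKr; apply/funext => x.
  by rewrite !fctE /= linB // addrA subrK.
apply: bndD; first by apply: bnd_comp => //; exact: ltW.
by apply: bnd_comp => //; [rewrite addr_ge0 // ltW|exact: bndB].
Qed.

Lemma fc_approx_adjoint g T T' : fc_approx A g T ->
  fc_approx A (fun z => Num.conj (g z)) T' -> is_adjoint T T'.
Proof.
move=> gT gT'; apply: adjoint_closed => d d0; have [p gp Tp] := gT d d0.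
exists (peval A p), (peval A (map_poly Num.conj p)); split=> //.
  exact: peval_adjoint.
apply: fc_approx_any gT' (ltW d0) _ => l sl.
rewrite [in X in _ - X](sa_spectrum_real sA sl) -[in X in _ - X](conjR (complex.Re l)).
by rewrite horner_map -rmorphB nrm_conj /= -(sa_spectrum_real sA sl) gp.
Qed.

Lemma fc_approx_peval p : fc_approx A (horner p) (peval A p).
Proof.
move=> e e0; exists p => [l _|]; first by rewrite subrr nrm0 ltW.
by rewrite subrr; apply: bnd_le bnd0; exact: ltW.
Qed.

Lemma fc_approx_one : fc_approx A (fun=> 1) id.
Proof.
have -> : (fun _ : R[i] => 1 : R[i]) = horner (1%:P : {poly R[i]}).
  by apply/funext => z; rewrite hornerC.
by have := fc_approx_peval 1%:P; rewrite pevalC scale1r.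
Qed.

Lemma fc_approx_id : fc_approx A id A.
Proof.
have -> : (id : R[i] -> R[i]) = horner ('X : {poly R[i]}).
  by apply/funext => z; rewrite hornerX.
by have := fc_approx_peval 'X; rewrite pevalX.
Qed.

Lemma fc_approx_isometry g T : fc_approx A g T ->
  op_norm T = sup [set complex.Re `|g l| | l in spectrum A].
Proof.
move=> gT; have bT := fc_approx_bounded gT.
(* On the zero space every operator is invertible: the spectrum is empty, and the default value 0 of
   the supremum is indeed the norm of [T]. *)
have [[x1 x10]|triv] := pselect (exists x : H, x != 0); last first.
  have H0 x : x = 0.
    by apply: contrapT => /eqP x0; apply: triv; exists x.
  have -> : [set complex.Re `|g l| | l in spectrum A] = set0.
    apply/seteqP; split=> // r [l sl _]; apply: sl; exists id; split.
    - exact: bounded_id.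
    - by apply/funext => x; rewrite [LHS]H0 [RHS]H0.
    - by apply/funext => x; rewrite [LHS]H0 [RHS]H0.
  rewrite sup0; apply/eqP; rewrite eq_le op_norm_ge0 andbT.
  by apply: op_norm_le => // x; rewrite [T x]H0 nrm0 mul0r.
have [l0 sl0] : exists l, spectrum A l.
  have [|a [sa _]] := spectrum_lower sA; first by exists x1.
  by exists a%:C.
have [M M0 [_ gM]] := fc_approx_bound gT.
set E := [set _ | _ in _].
have gs l : spectrum A l -> nrm (g l) <= sup E.
  move=> sl; apply: ub_le_sup; last by exists l.
  by exists M => _ [m sm <-]; exact: gM.
have s0 : 0 <= sup E by rewrite (le_trans (nrm_ge0 (g l0))) // gs.
apply/eqP; rewrite eq_le; apply/andP; split.
- apply: op_norm_le => //; apply: (@bnd_eps _ _ 2) => e e0.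
  have [p gp Tp] := gT e e0.
  have pA : bnd (sup E + e) (peval A p).
    apply: op_norm_peval_le => // [|l sl]; first by rewrite addr_ge0 // ltW.
    rewrite -[p.[l]](subrK (g l)) addrC (le_trans (nrmD _ _)) // lerD ?gs //.
    by rewrite nrmB gp.
  rewrite -[T](subrK (peval A p)).
  by apply: bnd_le (bndD Tp pA); lra.
- apply: ge_sup; first by exists (nrm (g l0)), l0.
  move=> _ [l sl <-]; apply/ler_addgt0Pr => e e0.
  have [p gp Tp] := gT (e / 2) (divr_gt0 e0 (ltr0n _ 2)).
  have pT : op_norm (peval A p) <= op_norm T + e / 2.
    apply: op_norm_le; first by rewrite addr_ge0 ?op_norm_ge0 // divr_ge0 // ltW.
    rewrite -[peval A p](subKr T); apply: bndB => //.
    exact: op_norm_ub.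
  rewrite -/(nrm (g l)) -(subrK p.[l] (g l)) (le_trans (nrmD _ _)) //.
  have := horner_norm_le p bA sl; have := gp l sl; lra.
Qed.

(** [Phi] chooses the operator related to [g], and 0 if there is none. Since the relation is
    functional, each algebraic identity amounts to checking that the expected operator is related to
    the combined function. *)
Lemma functional_calculus_exists : exists Phi, is_functional_calculus A Phi.
Proof.
pose Phi g : H -> H := xget 0 [set T | fc_approx A g T].
have PhiE g T : fc_approx A g T -> Phi g = T.
  move=> gT; apply: (@fc_approx_unique g) => //.
  by apply: (@xgetPex _ 0 [set T | fc_approx A g T]); exists T.
have PhiP g : continuous_on_spectrum A g -> fc_approx A g (Phi g).
  by move=> /fc_approx_exists[T gT]; rewrite (PhiE _ _ gT).
exists Phi; split.
- by move=> g /PhiP; exact: fc_approx_bounded.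
- by move=> a g h /PhiP cg /PhiP ch; apply: PhiE; exact: fc_approx_linear.
- by move=> g h /PhiP cg /PhiP ch; apply: PhiE; exact: fc_approx_mul.
- move=> g /[dup] cg /PhiP gT; apply: (fc_approx_adjoint gT); apply: PhiP.
  move/continuous_on_spectrumP : cg => cg; apply/continuous_on_spectrumP.
  move=> l sl e e0; have [d d0 hd] := cg l sl e e0; exists d => // m sm lm.
  by rewrite -rmorphB nrm_conj hd.
- by apply: PhiE; exact: fc_approx_one.
- by apply: PhiE; exact: fc_approx_id.
- by move=> g /PhiP; exact: fc_approx_isometry.
Qed.

Lemma functional_calculusP : is_functional_calculus A (functional_calculus A).
Proof.
exact: (@xgetPex _ _ [set Phi | is_functional_calculus A Phi]
  functional_calculus_exists).
Qed.

End SelfAdjoint.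

End FunctionalCalculus.

(** * The functional calculus on polynomials and on continuous functions *)

Lemma continuous_horner_num (K : numFieldType) (p : {poly K}) :
  continuous (horner p : K^o -> K^o).
Proof.
elim/poly_ind: p => [|p c IH] z.
  have -> : horner (0 : {poly K}) = fun=> 0.
    by apply/funext => w; rewrite horner0.
  exact: cst_continuous.
have -> : horner (p * 'X + c%:P) = fun w => p.[w] * w + c.
  by apply/funext => w; rewrite !hornerE.
have cp : {for z, continuous (horner p : K^o -> K^o)} by exact: IH.
have ci : {for z, continuous (id : K^o -> K^o)} by exact: cvg_id.
have cM := continuousM cp ci.
have cc : {for z, continuous (fun=> c : K^o)} by exact: cst_continuous.
exact: (continuousD cM cc).
Qed.

Section ContinuousFunctions.
Context {R : realType} {H : hilbertType R}.
Variables (A : H -> H) (J : set R) (f : R -> R).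
Hypotheses (sA : self_adjoint A) (A_J : spectrum_in A J)
  (f_cont : {within J, continuous f}).
Let bA : bounded_operator A. Proof. by case: sA. Qed.
Let linA : linear A. Proof. by case: bA. Qed.

Let fC := fun z : R[i] => (f (complex.Re z))%:C.

Lemma continuous_on_spectrum_Re : continuous_on_spectrum A fC.
Proof.
apply/continuous_on_spectrumP => l sl e e0.
have [r Jr lr] := A_J sl.
have /cvgrPdist_le /(_ e e0) := (subspace_continuousP _ _).1 f_cont r Jr.
rewrite near_withinE => /nbhs_ballP [d /= d0 hd]; exists d => // m sm.
have [s Js ms] := A_J sm; rewrite -lr -ms /fC /= -!rmorphB !nrmR => rs.
by apply: hd => //; rewrite -ball_normE.
Qed.

Lemma continuous_on_spectrum_horner (p : {poly R[i]}) :
  continuous_on_spectrum A (horner p).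
Proof.
exact: continuous_subspaceT (@continuous_horner_num _ p).
Qed.

(** [xget] returns an unspecified homomorphism, so its values on polynomials are derived from its
    specification: they are forced by the images of 1 and of the identity function. *)
Lemma functional_calculus_horner p : functional_calculus A (horner p) = peval A p.
Proof.
have PA := functional_calculusP sA; set Phi := functional_calculus A in PA *.
have c1 : continuous_on_spectrum A (fun=> 1).
  have := @continuous_on_spectrum_horner 1%:P.
  by have -> : horner 1%:P = (fun=> 1 : R[i]) by apply/funext => z; rewrite hornerC.
have cX : continuous_on_spectrum A id.
  have := @continuous_on_spectrum_horner 'X.
  by have -> : horner 'X = (id : R[i] -> R[i]) by apply/funext => z; rewrite hornerX.
have cp := @continuous_on_spectrum_horner.
elim/poly_ind: p => [|p c IH].
  (* Written so as to fit [fc_linear], the only additivity available. *)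
  have -> : horner 0 = (fun z : R[i] => -1 * (fun=> 1) z + (fun=> 1) z) :> (_ -> _).
    by apply/funext => z; rewrite horner0 mulN1r addNr.
  by rewrite (fc_linear PA _ c1 c1) scaleN1r addNr peval0.
have -> : horner (p * 'X + c%:P) = (fun z => c * (fun=> 1) z + (p * 'X).[z]).
  by apply/funext => z; rewrite hornerD hornerC mulr1 addrC.
rewrite (fc_linear PA _ c1 (cp (p * 'X))).
have -> : horner (p * 'X) = (fun z => id z * p.[z]).
  by apply/funext => z; rewrite hornerM hornerX mulrC.
by rewrite (fc_mul PA cX (cp p)) IH (fc_one PA) (fc_id PA) pevalD pevalMX // pevalC addrC.
Qed.

Lemma cfc_bounded : bounded_operator (cfc f A).
Proof. exact: (fc_bounded (functional_calculusP sA)) continuous_on_spectrum_Re. Qed.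

Lemma cfc_self_adjoint : self_adjoint (cfc f A).
Proof.
split; first exact: cfc_bounded.
have := fc_adjoint (functional_calculusP sA) continuous_on_spectrum_Re.
rewrite /cfc -/fC; have -> // : (fun z => Num.conj (fC z)) = fC.
by apply/funext => z; rewrite /fC conjR.
Qed.

(** The isometry applied to [f - p]. The bound involves [A] only through its spectrum, so one
    polynomial can serve a whole family of operators. *)
Lemma cfc_poly_approx (p : {poly R}) (e : R) : 0 <= e ->
  (forall r, spectrum A r%:C -> `|f r - p.[r]| <= e) ->
  bnd e (cfc f A - peval A (map_poly (real_complex R) p)).
Proof.
move=> e0 hp; have PA := functional_calculusP sA.
set P := map_poly _ p.
pose g z := -1 * P.[z] + fC z.
have gE : functional_calculus A g = cfc f A - peval A P.
  rewrite (fc_linear PA) ?functional_calculus_horner.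
  - by rewrite scaleN1r addrC.
  - exact: continuous_on_spectrum_horner.
  - exact: continuous_on_spectrum_Re.
have cg : continuous_on_spectrum A g.
  apply/continuous_on_spectrumP => l sl d d0.
  have d2 : 0 < d / 2 by rewrite divr_gt0.
  have := (continuous_on_spectrumP _ _).1 (@continuous_on_spectrum_horner P) l sl _ d2.
  move=> [u u0 hu].
  have := (continuous_on_spectrumP _ _).1 continuous_on_spectrum_Re l sl _ d2.
  move=> [v v0 hv].
  exists (Num.min u v); first by rewrite lt_min u0.
  move=> m sm; rewrite lt_min => /andP[lu lv].
  have -> : g l - g m = - (P.[l] - P.[m]) + (fC l - fC m) by rewrite /g; ring.
  by rewrite (le_trans (nrmD _ _)) // nrmN [leRHS]splitr lerD ?hu ?hv.
rewrite -gE; apply: bnd_le (op_norm_ub (fc_bounded PA cg)).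
rewrite (fc_isometry PA cg).
(* For an empty spectrum the supremum is 0 by default, which is at most [e]. *)
set E := [set _ | _ in _]; have [->|E0] := eqVneq E set0; first by rewrite sup0.
apply: ge_sup; first exact/set0P.
move=> _ [l sl <-]; rewrite -/(nrm (g l)) /g (sa_spectrum_real sA sl).
set r := complex.Re l; have sr : spectrum A r%:C by rewrite -(sa_spectrum_real sA sl).
by rewrite mulN1r horner_map addrC /fC /= -rmorphB nrmR hp.
Qed.

End ContinuousFunctions.

(** * Riemann sums of operator functions and existence of the integral *)

Section Integral.
Context {R : realType} {H : hilbertType R}.
Implicit Types (S T A B E : H -> H) (F G : R -> H -> H).

Lemma bnd_sum n (M : nat -> R) (D : nat -> H -> H) :
  (forall i, (i < n)%N -> bnd (M i) (D i)) ->
  bnd (\sum_(i < n) M i) (\sum_(i < n) D i).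
Proof.
elim: n => [|n IH] h; first by rewrite !big_ord0; exact: bnd0.
rewrite !big_ord_recr /=; apply: bndD; last exact: h.
by apply: IH => i ni; apply: h; rewrite ltnS ltnW.
Qed.

Lemma bounded_sum n (D : nat -> H -> H) : (forall i, (i < n)%N -> bounded_operator (D i)) ->
  bounded_operator (\sum_(i < n) D i).
Proof.
elim: n => [|n IH] h; first by rewrite big_ord0; exact: bounded0.
rewrite big_ord_recr /=; apply: boundedD; last exact: h.
by apply: IH => i ni; apply: h; rewrite ltnS ltnW.
Qed.

Lemma telescope_ord (V : zmodType) n (u : nat -> V) :
  \sum_(i < n) (u i.+1 - u i) = u n - u 0%N.
Proof.
elim: n => [|n IH]; first by rewrite big_ord0 subrr.
by rewrite big_ord_recr /= IH addrC subrKA.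
Qed.

Definition tagged_partition n (s xi : nat -> R) :=
  [/\ s 0%N = 0, s n = 1 & forall i, (i < n)%N -> s i <= xi i <= s i.+1].

Definition riemann n (s xi : nat -> R) F :=
  \sum_(i < n) (s i.+1 - s i)%:C *: F (xi i).

Lemma tagged_partition_bounds n s xi : tagged_partition n s xi ->
  forall i, (i < n)%N -> [/\ 0 <= s i, s i <= xi i, xi i <= s i.+1 & s i.+1 <= 1].
Proof.
move=> [s0 sn h] i ni.
have mono j k : (j + k <= n)%N -> s j <= s (j + k)%N.
  elim: k => [|k IH] jk; first by rewrite addn0.
  move: jk; rewrite addnS => jk.
  rewrite (le_trans (IH (ltnW jk))) //.
  by have /andP[+ +] := h _ jk; exact: le_trans.
have /andP[h1 h2] := h i ni; split=> //.
- by have := mono 0%N i; rewrite add0n s0; apply; exact: ltnW.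
- by have := mono i.+1 (n - i.+1)%N; rewrite subnKC // sn; apply.
Qed.

(** The weights are nonnegative and telescope to 1, so the error does not grow with [n]. *)
Lemma riemann_close n s xi F F' (e : R) : tagged_partition n s xi ->
  (forall t, 0 <= t <= 1 -> bnd e (F t - F' t)) ->
  bnd e (riemann n s xi F - riemann n s xi F').
Proof.
move=> sP h; rewrite /riemann -sumrB.
have [s0 s1 _] := sP.
have -> : e = \sum_(i < n) (s i.+1 - s i) * e.
  by rewrite -mulr_suml telescope_ord s0 s1 subr0 mul1r.
apply: (@bnd_sum _ (fun i => (s i.+1 - s i) * e)
  (fun i => (s i.+1 - s i)%:C *: F (xi i) - (s i.+1 - s i)%:C *: F' (xi i))) => i ni.
have [h0 h1 h2 h3] := tagged_partition_bounds sP ni.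
rewrite -scalerBr -[X in X * e]ger0_norm ?subr_ge0; last exact: le_trans h2.
rewrite -nrmR; apply: bndZ; apply: h.
by rewrite (le_trans h0 h1) (le_trans h2 h3).
Qed.

(* [F] has a primitive up to a quadratic error, so that its Riemann sums
   telescope. *)
Definition has_primitive F := exists2 G : R -> H -> H,
  (forall t, bounded_operator (F t)) /\ (forall t, bounded_operator (G t)) &
  exists2 C : R, 0 <= C & forall u xi v, 0 <= u -> u <= xi -> xi <= v -> v <= 1 ->
    bnd (C * (v - u) ^+ 2) (G v - G u - (v - u)%:C *: F xi).

(** On a cell of length [h < e / (C + 1)] the error [C h^2] is at most [e h], and the lengths add up
    to 1. *)
Lemma has_primitive_riemann F : has_primitive F ->
  exists2 T, bounded_operator T & forall e : R, 0 < e -> exists2 d : R, 0 < d &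
    forall n s xi, tagged_partition n s xi ->
      (forall i, (i < n)%N -> s i.+1 - s i < d) -> bnd e (T - riemann n s xi F).
Proof.
move=> [G [bF bG] [C C0 hC]]; exists (G 1 - G 0); first exact: boundedB.
move=> e e0; have c0 : 0 < C + 1 by rewrite ltr_wpDl.
exists (e / (C + 1)); first by rewrite divr_gt0.
move=> n s xi sP sd; have [s0 s1 _] := sP.
rewrite -{1}s1 -s0 -(telescope_ord n (fun i => G (s i))) /riemann -sumrB.
have -> : e = \sum_(i < n) (s i.+1 - s i) * e.
  by rewrite -mulr_suml telescope_ord s0 s1 subr0 mul1r.
apply: (@bnd_sum _ (fun i => (s i.+1 - s i) * e)
  (fun i => G (s i.+1) - G (s i) - (s i.+1 - s i)%:C *: F (xi i))) => i ni.
have [h0 h1 h2 h3] := tagged_partition_bounds sP ni.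
apply: bnd_le (hC _ _ _ h0 h1 h2 h3).
rewrite expr2 mulrCA ler_wpM2l ?subr_ge0 ?(le_trans h1 h2) //.
have := ltW (sd i ni); rewrite ler_pdivlMr // => h.
rewrite (le_trans _ h) // mulrC ler_wpM2l ?subr_ge0 ?(le_trans h1 h2) //.
by rewrite lerDl.
Qed.

Lemma has_primitiveD F F' : has_primitive F -> has_primitive F' ->
  has_primitive (fun t => F t + F' t).
Proof.
move=> [G [bF bG] [C C0 hC]] [G' [bF' bG'] [C' C0' hC']].
exists (fun t => G t + G' t); first by split=> t; exact: boundedD.
exists (C + C'); first exact: addr_ge0.
move=> u xi v u0 uxi xiv v1.
have -> : G v + G' v - (G u + G' u) - (v - u)%:C *: (F xi + F' xi) =
    (G v - G u - (v - u)%:C *: F xi) + (G' v - G' u - (v - u)%:C *: F' xi).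
  by rewrite scalerDr !opprD [RHS]addrACA [X in X + _ = _]addrACA.
by rewrite mulrDl; apply: bndD; [exact: hC|exact: hC'].
Qed.

(** The mean value estimate for a power, obtained without derivatives: each bound follows by
    induction from one of the two ways to split the difference of two products. *)
Lemma exprS_sub_bounds j (u v : R) : 0 <= u -> u <= v ->
  j.+1%:R * (v - u) * u ^+ j <= v ^+ j.+1 - u ^+ j.+1 <= j.+1%:R * (v - u) * v ^+ j.
Proof.
move=> u0 uv; have v0 := le_trans u0 uv; have vu : 0 <= v - u by rewrite subr_ge0.
elim: j => [|j /andP[IH1 IH2]]; first by rewrite !expr0 !expr1 !mulr1 mul1r lexx.
have uvj : u ^+ j.+1 <= v ^+ j.+1 by rewrite ler_pXn2r ?nnegrE.
have h1 := ler_wpM2l u0 IH1; have h2 := ler_wpM2l v0 IH2.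
have h3 := ler_wpM2l vu uvj.
apply/andP; split.
- have -> : v ^+ j.+2 - u ^+ j.+2 =
      u * (v ^+ j.+1 - u ^+ j.+1) + (v - u) * v ^+ j.+1 by rewrite !exprS; ring.
  apply: le_trans (lerD h1 h3); rewrite -[j.+2%:R]natr1 le_eqVlt; apply/orP; left.
  by apply/eqP; rewrite !exprS; ring.
- have -> : v ^+ j.+2 - u ^+ j.+2 =
      v * (v ^+ j.+1 - u ^+ j.+1) + (v - u) * u ^+ j.+1 by rewrite !exprS; ring.
  apply: le_trans (lerD h2 h3) _; rewrite -[j.+2%:R]natr1 le_eqVlt; apply/orP; left.
  by apply/eqP; rewrite !exprS; ring.
Qed.

(** The increment of the primitive and [(v - u) xi^j] both lie between [(v - u) u^j] and
    [(v - u) v^j], whose gap is at most [j (v - u)^2] on the unit interval. *)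
Lemma monomial_primitive j (u xi v : R) : 0 <= u -> u <= xi -> xi <= v -> v <= 1 ->
  `|v ^+ j.+1 / j.+1%:R - u ^+ j.+1 / j.+1%:R - (v - u) * xi ^+ j| <= j%:R * (v - u) ^+ 2.
Proof.
move=> u0 ux xv v1; have uv := le_trans ux xv.
have x0 := le_trans u0 ux; have v0 := le_trans x0 xv.
have vu : 0 <= v - u by rewrite subr_ge0.
have j0 : (0 : R) < j.+1%:R by rewrite ltr0n.
have /andP[h1 h2] := exprS_sub_bounds j u0 uv.
have h1' : (v - u) * u ^+ j <= (v ^+ j.+1 - u ^+ j.+1) / j.+1%:R.
  by rewrite ler_pdivlMr // mulrC mulrA.
have h2' : (v ^+ j.+1 - u ^+ j.+1) / j.+1%:R <= (v - u) * v ^+ j.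
  by rewrite ler_pdivrMr // [leRHS]mulrC mulrA.
have ux' : (v - u) * u ^+ j <= (v - u) * xi ^+ j.
  by rewrite ler_wpM2l // lerXn2r ?nnegrE.
have xv' : (v - u) * xi ^+ j <= (v - u) * v ^+ j.
  by rewrite ler_wpM2l // lerXn2r ?nnegrE.
have d : (v - u) * v ^+ j - (v - u) * u ^+ j <= j%:R * (v - u) ^+ 2.
  rewrite -mulrBr expr2 mulrCA ler_wpM2l //.
  case: j {h1 h2 h1' h2' ux' xv' j0} => [|j]; first by rewrite !expr0 subrr mul0r.
  have /andP[_ h] := exprS_sub_bounds j u0 uv.
  rewrite (le_trans h) // ler_piMr ?mulr_ge0 ?ler0n //.
  exact: exprn_ile1.
have squeeze (a b c w M : R) : a <= w -> w <= b -> a <= c -> c <= b ->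
    b - a <= M -> `|w - c| <= M.
  by move=> ? ? ? ? ?; rewrite ler_norml; apply/andP; split; lra.
by rewrite -mulrBl; exact: squeeze h1' h2' ux' xv' d.
Qed.

Lemma has_primitive_monomial j E : bounded_operator E ->
  has_primitive (fun t => (t ^+ j)%:C *: E).
Proof.
move=> bE; exists (fun t => (t ^+ j.+1 / j.+1%:R)%:C *: E).
  by split=> t; exact: boundedZ.
exists (j%:R * op_norm E); first by rewrite mulr_ge0 ?op_norm_ge0 ?ler0n.
move=> u xi v u0 uxi xiv v1.
rewrite scalerA -!scalerBl -rmorphM -!rmorphB.
apply: bnd_le (bndZ _ (op_norm_ub bE)).
by rewrite nrmR mulrAC ler_wpM2r ?op_norm_ge0 ?monomial_primitive.
Qed.

Lemma has_primitive_peval A B p : bounded_operator A -> bounded_operator B ->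
  has_primitive (fun t => peval (op_conv t A B) p).
Proof.
move=> bA bB.
(* As [op_conv t A B] is [B + t (A - B)], splitting off one factor replaces [E] by [E \o B], or by
   [E \o (A - B)] with one more power of [t]. Carrying [E] and [t ^+ j] closes the induction
   although [A] and [B] need not commute. *)
suff h E j : bounded_operator E ->
    has_primitive (fun t => (t ^+ j)%:C *: (E \o peval (op_conv t A B) p)).
  have -> : (fun t => peval (op_conv t A B) p) =
      (fun t => (t ^+ 0)%:C *: (id \o peval (op_conv t A B) p)).
    by apply/funext => t; rewrite expr0 scale1r.
  exact/h/bounded_id.
have bC t : bounded_operator (op_conv t A B).
  by apply: boundedD; exact: boundedZ.
elim/poly_ind: p E j => [|p c IH] E j bE.
  have -> : (fun t => (t ^+ j)%:C *: (E \o peval (op_conv t A B) 0)) =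
      (fun t => (t ^+ j)%:C *: 0).
    apply/funext => t; congr (_ *: _); apply/funext => x.
    by rewrite peval0 /= lin0 //; case: bE.
  by apply: has_primitive_monomial; exact: bounded0.
have -> : (fun t => (t ^+ j)%:C *: (E \o peval (op_conv t A B) (p * 'X + c%:P))) =
    (fun t => (t ^+ j)%:C *: ((E \o B) \o peval (op_conv t A B) p) +
      (t ^+ j.+1)%:C *: ((E \o (A - B)) \o peval (op_conv t A B) p) +
      (t ^+ j)%:C *: (c *: E)).
  apply/funext => t; have [linE _] := bE; have [linC _] := bC t.
  rewrite exprSr rmorphM -scalerA -!scalerDr; congr (_ *: _).
  rewrite pevalD pevalMX // pevalC; apply/funext => x.
  rewrite /= !fctE /= (linD linE) (linZ linE); congr (_ + _).
  set y := peval _ _ _; rewrite /op_conv !fctE.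
  rewrite (linD linE) !(linZ linE) (linB linE) rmorphB scalerBl scale1r scalerBr.
  by rewrite addrCA.
apply: has_primitiveD; first apply: has_primitiveD.
- by apply: IH; exact: bounded_comp.
- by apply: IH; apply: bounded_comp => //; exact: boundedB.
- by apply: has_primitive_monomial; exact: boundedZ.
Qed.

Lemma uniform_partition n : (0 < n)%N ->
  tagged_partition n (fun i => i%:R / n%:R) (fun i => i%:R / n%:R).
Proof.
move=> n0; split; first by rewrite mul0r.
  by rewrite divff // pnatr_eq0 -lt0n.
by move=> i _; rewrite lexx ler_wpM2r ?invr_ge0 ?ler0n // ler_nat.
Qed.

(** For each [e], the integral of an approximant is close to all fine Riemann sums of [F]. This
    makes the sums over uniform partitions Cauchy, and then compares their limit with arbitrary fine
    tagged partitions. *)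
Lemma op_integral_exists F : (forall t, 0 <= t <= 1 -> bounded_operator (F t)) ->
  (forall e : R, 0 < e -> exists2 F', has_primitive F' &
    forall t, 0 <= t <= 1 -> bnd e (F t - F' t)) ->
  is_op_integral 0 1 F (op_integral 0 1 F).
Proof.
move=> bF hF; apply: (@xgetPex _ 0 [set T | is_op_integral 0 1 F T]).
have near_int (e : R) : 0 < e -> exists2 T, bounded_operator T &
    exists2 d : R, 0 < d & forall n s xi, tagged_partition n s xi ->
      (forall i, (i < n)%N -> s i.+1 - s i < d) -> bnd e (T - riemann n s xi F).
  move=> e0; have e2 : 0 < e / 2 by rewrite divr_gt0.
  have [F' pF' FF'] := hF _ e2.
  have [T bT hT] := has_primitive_riemann pF'; have [d d0 hd] := hT _ e2.
  exists T => //; exists d => // n s xi sP sd.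
  have -> : T - riemann n s xi F =
      (T - riemann n s xi F') - (riemann n s xi F - riemann n s xi F').
    by rewrite opprB subrKA.
  rewrite [e]splitr; apply: bndB; [exact: hd|exact: riemann_close].
(* The shift to [n.+1] cells avoids the partition without cells. *)
pose U n := riemann n.+1 (fun i => i%:R / n.+1%:R) (fun i => i%:R / n.+1%:R) F.
have U_near (d : R) : 0 < d -> exists N, forall n i, (N <= n)%N -> (i < n.+1)%N ->
    i.+1%:R / n.+1%:R - i%:R / n.+1%:R < d :> R.
  move=> d0; exists (Num.truncn d^-1) => n i Nn _.
  rewrite -mulrBl -natr1 addrAC subrr add0r mul1r.
  rewrite -[ltRHS]invrK ltf_pV2 ?posrE ?ltr0n ?invr_gt0 //.
  by rewrite (lt_le_trans (truncnS_gt _)) // ler_nat.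
have [e e0|T hT] := @op_complete _ _ U.
  have e2 : 0 < e / 2 by rewrite divr_gt0.
  have [T' _ [d d0 hd]] := near_int _ e2; have [N hN] := U_near d d0.
  exists N => m n Nm Nn.
  have -> : U m - U n = (T' - U n) - (T' - U m) by rewrite opprB [RHS]addrC subrKA.
  by rewrite [e]splitr; apply: bndB; apply: hd;
    [exact: uniform_partition|move=> i; exact: hN|
     exact: uniform_partition|move=> i; exact: hN].
have T_near (e : R) : 0 < e -> exists2 d : R, 0 < d &
    forall n s xi, tagged_partition n s xi ->
      (forall i, (i < n)%N -> s i.+1 - s i < d) -> bnd e (T - riemann n s xi F).
  move=> e0; have e3 : 0 < e / 3 by rewrite divr_gt0.
  have [T' _ [d d0 hd]] := near_int _ e3.
  have [M hM] := hT _ e3; have [N hN] := U_near d d0.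
  exists d => // n s xi sP sd.
  have -> : T - riemann n s xi F = (T - U (maxn M N)) - (T' - U (maxn M N)) +
      (T' - riemann n s xi F).
    by rewrite opprB subrKA subrKA.
  have -> : e = e / 3 + e / 3 + e / 3 by field.
  apply: bndD; last exact: hd.
  apply: bndB; first by apply: hM; exact: leq_maxl.
  apply: hd; first exact: uniform_partition.
  by move=> i; apply: hN; exact: leq_maxr.
exists T; split=> //.
- apply: bounded_operator_closed => e e0; have [M hM] := hT _ e0.
  exists (U M); last exact: hM.
  apply: (@bounded_sum M.+1 (fun i => (i.+1%:R / M.+1%:R - i%:R / M.+1%:R)%:C *:
    F (i%:R / M.+1%:R))) => i iM.
  apply: boundedZ; apply: bF; rewrite divr_ge0 ?ler0n //=.
  by rewrite ler_pdivrMr ?ltr0n // mul1r ler_nat ltnW.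
- move=> e e0; have e2 : 0 < e / 2 by rewrite divr_gt0.
  have [d d0 hd] := T_near _ e2; exists d => // n s xi s0 s1 sxi sd.
  have ee : e / 2 < e by rewrite ltr_pdivrMr // ltr_pMr // ltr1n.
  apply: le_lt_trans ee; apply: op_norm_le; first exact: ltW.
  by rewrite -opprB; apply: bndN; apply: hd.
Qed.

End Integral.

(** * Midpoint and trapezoidal sums of a convex function *)

Section ScalarHermiteHadamard.
Context {R : realType}.
Implicit Types (phi : R -> R) (n N : nat).

Definition convex_unit phi := forall s u v, 0 <= s <= 1 -> 0 <= u <= 1 ->
  0 <= v <= 1 -> phi (s * u + (1 - s) * v) <= s * phi u + (1 - s) * phi v.

(** Left unnormalised, so that refinement is additive: this is [n] times the midpoint rule, and
    [trapezoid_sum] is [2 n] times the trapezoidal rule. *)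
Definition midpoint_sum phi n : R :=
  \sum_(i < n) phi ((2 * i + 1)%:R / (2 * n)%:R).

Definition trapezoid_sum phi n : R :=
  \sum_(i < n) (phi (i.+1%:R / n%:R) + phi (i%:R / n%:R)).

Lemma sum_rev_ord n (F : nat -> R) : \sum_(i < n) F (n - i.+1)%N = \sum_(i < n) F i.
Proof. by rewrite [RHS](reindex_inj rev_ord_inj). Qed.

Lemma midpoint_rev n (i : 'I_n) :
  (2 * (n - i.+1) + 1)%:R / (2 * n)%:R = 1 - (2 * i + 1)%:R / (2 * n)%:R :> R.
Proof.
have n0 : (n%:R : R) != 0 by rewrite pnatr_eq0 -lt0n (leq_trans _ (ltn_ord i)).
rewrite !addn1 -!natr1 !natrM natrB // -natr1; field.
by rewrite n0.
Qed.

Lemma midpoint_unit n (i : 'I_n) : 0 <= ((2 * i + 1)%:R / (2 * n)%:R : R) <= 1.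
Proof.
have n0 : (0 < n)%N by rewrite (leq_trans _ (ltn_ord i)).
rewrite divr_ge0 ?ler0n //= ler_pdivrMr ?ltr0n ?muln_gt0 //= mul1r ler_nat.
by rewrite addn1 ltn_pmul2l.
Qed.

Lemma grid_unit n i : (0 < n)%N -> (i <= n)%N -> 0 <= (i%:R / n%:R : R) <= 1.
Proof.
by move=> n0 ni; rewrite divr_ge0 ?ler0n //= ler_pdivrMr ?ltr0n // mul1r ler_nat.
Qed.

Lemma convex_half phi u : convex_unit phi -> 0 <= u <= 1 ->
  phi (1 / 2) <= (phi u + phi (1 - u)) / 2.
Proof.
move=> cphi u01; have := cphi (1 / 2) u (1 - u) _ u01 _.
have -> : 1 / 2 * u + (1 - 1 / 2) * (1 - u) = 1 / 2 :> R by field.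
by move=> h; have := h _ _; lra.
Qed.

Lemma convex_ends phi u : convex_unit phi -> 0 <= u <= 1 ->
  phi u + phi (1 - u) <= phi 1 + phi 0.
Proof.
move=> cphi u01; have h01 : 0 <= (0 : R) <= 1 by rewrite lexx ler01.
have h11 : 0 <= (1 : R) <= 1 by rewrite lexx ler01.
have u01' : 0 <= 1 - u <= 1 by lra.
have := cphi u 1 0 u01 h11 h01; have := cphi (1 - u) 1 0 u01' h11 h01.
by rewrite !mulr1 !mulr0 !addr0; lra.
Qed.

Lemma midpoint_sum_sym phi n :
  midpoint_sum phi n = \sum_(i < n) (phi ((2 * i + 1)%:R / (2 * n)%:R) +
    phi (1 - (2 * i + 1)%:R / (2 * n)%:R)) / 2.
Proof.
rewrite -mulr_suml big_split /=.
have <- : midpoint_sum phi n =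
    \sum_(i < n) phi (1 - (2 * i + 1)%:R / (2 * n)%:R).
  rewrite /midpoint_sum.
  rewrite -(sum_rev_ord n (fun i => phi ((2 * i + 1)%:R / (2 * n)%:R))).
  by apply: eq_bigr => i _; rewrite midpoint_rev.
by rewrite -/(midpoint_sum phi n); field.
Qed.

Lemma midpoint_ge phi n : convex_unit phi ->
  n%:R * phi (1 / 2) <= midpoint_sum phi n.
Proof.
move=> cphi; rewrite midpoint_sum_sym.
have -> : n%:R * phi (1 / 2) = \sum_(i < n) phi (1 / 2).
  by rewrite sumr_const card_ord mulr_natl.
by apply: ler_sum => i _; apply: convex_half => //; exact: midpoint_unit.
Qed.

Lemma midpoint_le phi n : convex_unit phi ->
  midpoint_sum phi n <= n%:R * ((phi 1 + phi 0) / 2).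
Proof.
move=> cphi; rewrite midpoint_sum_sym.
have -> : n%:R * ((phi 1 + phi 0) / 2) = \sum_(i < n) ((phi 1 + phi 0) / 2).
  by rewrite sumr_const card_ord mulr_natl.
apply: ler_sum => i _; rewrite ler_pM2r ?invr_gt0 //.
by apply: convex_ends => //; exact: midpoint_unit.
Qed.

Lemma trapezoid_le phi n : convex_unit phi ->
  trapezoid_sum phi n <= n%:R * (phi 1 + phi 0).
Proof.
move=> cphi; rewrite /trapezoid_sum big_split /=.
(* Reversing the left end points matches [(i + 1) / n] with its reflection [1 - (i + 1) / n]. *)
rewrite -(sum_rev_ord n (fun i => phi (i%:R / n%:R))) -big_split /=.
have -> : n%:R * (phi 1 + phi 0) = \sum_(i < n) (phi 1 + phi 0).
  by rewrite sumr_const card_ord mulr_natl.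
apply: ler_sum => i _; have n0 : (0 < n)%N by rewrite (leq_trans _ (ltn_ord i)).
have -> : (n - i.+1)%:R / n%:R = 1 - i.+1%:R / n%:R :> R.
  by rewrite natrB // mulrBl divff // pnatr_eq0 -lt0n.
by apply: convex_ends => //; exact: grid_unit.
Qed.

Lemma sum_ord_mul N n (F : nat -> R) :
  \sum_(k < N * n) F k = \sum_(i < N) \sum_(j < n) F (i * n + j)%N.
Proof.
elim: N => [|N IH]; first by rewrite mul0n !big_ord0.
by rewrite big_ord_recr /= -IH mulSnr big_split_ord.
Qed.

Lemma convex_cell phi N (i : 'I_N) : convex_unit phi ->
  convex_unit (fun s => phi ((i%:R + s) / N%:R)).
Proof.
move=> cphi s u v s01 u01 v01.
have n0 : (0 < N)%N by rewrite (leq_trans _ (ltn_ord i)).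
have n1 : (N%:R : R) != 0 by rewrite pnatr_eq0 -lt0n.
have cell (w : R) : 0 <= w <= 1 -> 0 <= (i%:R + w) / N%:R <= 1.
  move=> /andP[w0 w1]; rewrite divr_ge0 ?addr_ge0 ?ler0n //=.
  rewrite ler_pdivrMr ?ltr0n // mul1r (@le_trans _ _ i.+1%:R) ?ler_nat //.
  by rewrite -natr1 lerD2l.
have -> : (i%:R + (s * u + (1 - s) * v)) / N%:R =
    s * ((i%:R + u) / N%:R) + (1 - s) * ((i%:R + v) / N%:R) by field.
by apply: cphi => //; exact: cell.
Qed.

(** The fine node of index [i * n + j] is the [j]-th midpoint inside the [i]-th coarse cell,
    rescaled to the unit interval. *)
Lemma midpoint_refine phi N n : (0 < n)%N ->
  midpoint_sum phi (N * n) =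
  \sum_(i < N) midpoint_sum (fun s => phi ((i%:R + s) / N%:R)) n.
Proof.
move=> n0; have n1 : (n%:R : R) != 0 by rewrite pnatr_eq0 -lt0n.
rewrite /midpoint_sum.
rewrite (sum_ord_mul N n (fun k => phi ((2 * k + 1)%:R / (2 * (N * n))%:R))).
apply: eq_bigr => i _; apply: eq_bigr => j _.
have N1 : (N%:R : R) != 0.
  by rewrite pnatr_eq0 -lt0n (leq_trans _ (ltn_ord i)).
congr phi; rewrite !addn1 -!natr1 !natrM natrD natrM; field.
by rewrite n1 N1.
Qed.

(** [midpoint_ge] on each coarse cell, whose centre is the coarse midpoint node. *)
Lemma midpoint_refine_ge phi N n : convex_unit phi -> (0 < n)%N ->
  n%:R * midpoint_sum phi N <= midpoint_sum phi (N * n).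
Proof.
move=> cphi n0; rewrite midpoint_refine // /midpoint_sum mulr_sumr.
apply: ler_sum => i _; apply: le_trans (midpoint_ge n (convex_cell i cphi)).
have N1 : (N%:R : R) != 0.
  by rewrite pnatr_eq0 -lt0n (leq_trans _ (ltn_ord i)).
rewrite le_eqVlt; apply/orP; left; apply/eqP; congr (_ * phi _).
by rewrite addn1 -natr1 !natrM; field.
Qed.

(** [midpoint_le] on each coarse cell, whose end points are the trapezoidal nodes. *)
Lemma midpoint_refine_le phi N n : convex_unit phi -> (0 < n)%N ->
  midpoint_sum phi (N * n) <= n%:R * (trapezoid_sum phi N / 2).
Proof.
move=> cphi n0; rewrite midpoint_refine // /trapezoid_sum mulr_suml mulr_sumr.
apply: ler_sum => i _; apply: le_trans (midpoint_le n (convex_cell i cphi)) _.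
by rewrite addr0 natr1.
Qed.

End ScalarHermiteHadamard.

(** * Order and spectra along the segment between two operators *)

Section OperatorSegment.
Context {R : realType} {H : hilbertType R}.
Implicit Types (S T A B : H -> H).

Lemma ri_sum n (D : nat -> H -> H) (x : H) :
  ri ((\sum_(i < n) D i) x) x = \sum_(i < n) ri (D i x) x.
Proof.
elim: n => [|n IH]; first by rewrite !big_ord0 /ri inner0l.
by rewrite !big_ord_recr /= -IH -riDl.
Qed.

Lemma sa_sum n (D : nat -> H -> H) : (forall i, (i < n)%N -> self_adjoint (D i)) ->
  self_adjoint (\sum_(i < n) D i).
Proof.
elim: n => [|n IH] h.
  by rewrite big_ord0; split; [exact: bounded0|exact: adjoint0].
rewrite big_ord_recr /=; apply: saD; last exact: h.
by apply: IH => i ni; apply: h; rewrite ltnS ltnW.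
Qed.

(** [op_le] also asks the form to be real, which is what self-adjointness supplies. *)
Lemma op_leP S T : self_adjoint S -> self_adjoint T ->
  (forall x, ri (S x) x <= ri (T x) x) -> op_le S T.
Proof.
move=> sS sT h x; rewrite (sa_inner x (saB sT sS)) ler0c !fctE riBl subr_ge0.
exact: h.
Qed.

Lemma op_le_ri S T x : op_le S T -> ri (S x) x <= ri (T x) x.
Proof.
move=> /(_ x); rewrite lecE /= => /andP[_].
by rewrite -/(ri _ _) !fctE riBl subr_ge0.
Qed.

Lemma op_conv_sa t A B : self_adjoint A -> self_adjoint B ->
  self_adjoint (op_conv t A B).
Proof. by move=> sA sB; apply: saD; exact: saZ. Qed.

Lemma op_conv_conv s u v A B :
  op_conv s (op_conv u A B) (op_conv v A B) = op_conv (s * u + (1 - s) * v) A B.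
Proof.
rewrite /op_conv !scalerDr !scalerA addrACA -!scalerDl -!rmorphM -!rmorphD.
by congr (_%:C *: _ + _%:C *: _); ring.
Qed.

(** The end points are extremal points of the two spectra, hence lie in [J]: the segment stays
    inside [J] even when [J] is not closed, and one compact set serves every [t]. *)
Lemma op_conv_spectrum A B (J : set R) : self_adjoint A -> self_adjoint B ->
  is_interval J -> spectrum_in A J -> spectrum_in B J ->
  (exists x : H, x != 0) -> exists m M : R, `[m, M] `<=` J /\
    forall t, 0 <= t <= 1 -> spectrum_in (op_conv t A B) `[m, M].
Proof.
move=> sA sB Jitv AJ BJ x1.
have [a [sa la]] := spectrum_lower sA x1; have [b [sb ub]] := spectrum_upper sA x1.
have [c [sc lc]] := spectrum_lower sB x1; have [d [sd ud]] := spectrum_upper sB x1.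
have inJ C (r : R) : spectrum_in C J -> spectrum C r%:C -> J r.
  by move=> CJ /CJ[s Js /complexI <-].
exists (Num.min a c), (Num.max b d); split.
  move=> r; rewrite /= in_itv /= => h; apply: (Jitv _ _ _ _ _ h).
    by rewrite minEle; case: ifP => _; [exact: inJ sa|exact: inJ sc].
  by rewrite maxEle; case: ifP => _; [exact: inJ sd|exact: inJ sb].
move=> t /andP[t0 t1]; have t1' : 0 <= 1 - t by rewrite subr_ge0.
apply: spectrum_sub_bounds; first exact: op_conv_sa.
- move=> x; rewrite /op_conv !fctE riDl !riZl.
  have n0 : 0 <= nrm x ^+ 2 by exact: sqr_ge0.
  have hA : Num.min a c * nrm x ^+ 2 <= ri (A x) x.
    by rewrite (le_trans _ (la x)) // ler_wpM2r // ge_min lexx.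
  have hB : Num.min a c * nrm x ^+ 2 <= ri (B x) x.
    by rewrite (le_trans _ (lc x)) // ler_wpM2r // ge_min lexx orbT.
  have := ler_wpM2l t0 hA; have := ler_wpM2l t1' hB; lra.
- move=> x; rewrite /op_conv !fctE riDl !riZl.
  have n0 : 0 <= nrm x ^+ 2 by exact: sqr_ge0.
  have hA : ri (A x) x <= Num.max b d * nrm x ^+ 2.
    by rewrite (le_trans (ub x)) // ler_wpM2r // le_max lexx.
  have hB : ri (B x) x <= Num.max b d * nrm x ^+ 2.
    by rewrite (le_trans (ud x)) // ler_wpM2r // le_max lexx orbT.
  have := ler_wpM2l t0 hA; have := ler_wpM2l t1' hB; lra.
Qed.

End OperatorSegment.

Lemma op_conv1 (R : realType) (H : hilbertType R) (A B : H -> H) :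
  op_conv 1 A B = A.
Proof. by rewrite /op_conv subrr scale1r scale0r addr0. Qed.

Lemma op_conv0 (R : realType) (H : hilbertType R) (A B : H -> H) :
  op_conv 0 A B = B.
Proof. by rewrite /op_conv subr0 scale1r scale0r add0r. Qed.

Lemma op_conv_half (R : realType) (H : hilbertType R) (A B : H -> H) :
  op_conv (1 / 2) A B = (1 / 2 : R)%:C *: (A + B).
Proof.
by rewrite /op_conv scalerDr; congr (_ + _%:C *: _); field.
Qed.

(** * The operator integral between midpoint and trapezoidal sums *)

Section HermiteHadamard.
Context {R : realType} {H : hilbertType R}.
Variables (A B : H -> H) (J : set R) (f : R -> R).
Hypotheses (A_sa : self_adjoint A) (B_sa : self_adjoint B) (J_itv : is_interval J)
    (A_J : spectrum_in A J) (B_J : spectrum_in B J)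
    (f_cont : {within J, continuous f}) (f_conv : operator_convex J f)
    (H_neq0 : exists x : H, x != 0).

Let fc t := cfc f (op_conv t A B).
Let phi x t := ri (fc t x) x.
Let integral := op_integral 0 1 fc.

Let conv_sa t : self_adjoint (op_conv t A B).
Proof. exact: op_conv_sa. Qed.

Let conv_J t : 0 <= t <= 1 -> spectrum_in (op_conv t A B) J.
Proof.
move=> t01 l sl.
have [m [M [mMJ /(_ t t01) sp]]] := op_conv_spectrum A_sa B_sa J_itv A_J B_J H_neq0.
by have [r rmM <-] := sp l sl; exists r => //; exact: mMJ.
Qed.

Lemma cfc_conv_sa t : 0 <= t <= 1 -> self_adjoint (fc t).
Proof. by move=> t01; apply: cfc_self_adjoint f_cont; [|exact: conv_J]. Qed.

Lemma cfc_conv_convex x : convex_unit (phi x).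
Proof.
move=> s u v s01 u01 v01; rewrite /phi /fc -op_conv_conv.
have := f_conv (conv_sa u) (conv_sa v) (conv_J u01) (conv_J v01) s01.
by move=> /(@op_le_ri _ _ _ _ x); rewrite {3}/op_conv !fctE riDl !riZl.
Qed.

Lemma cfc_conv_integral : is_op_integral 0 1 fc integral.
Proof.
apply: op_integral_exists => [t /cfc_conv_sa[] //|e e0].
have [m [M [mMJ sp]]] := op_conv_spectrum A_sa B_sa J_itv A_J B_J H_neq0.
have [p hp] := weierstrass (@segment_compact R m M)
  (continuous_subspaceW mMJ f_cont) e0.
exists (fun t => peval (op_conv t A B) (map_poly (real_complex R) p)).
  by apply: has_primitive_peval; [case: A_sa|case: B_sa].
move=> t t01; apply: cfc_poly_approx f_cont _ _ _ _ => //.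
- exact: conv_J.
- exact: ltW.
- by move=> r /(sp t t01)[s smM /complexI <-]; exact: hp.
Qed.

Lemma integral_riemann (e : R) : 0 < e -> exists2 d : R, 0 < d &
  forall n s xi, tagged_partition n s xi ->
    (forall i, (i < n)%N -> s i.+1 - s i < d) ->
    self_adjoint (riemann n s xi fc) /\ bnd e (integral - riemann n s xi fc).
Proof.
have [_ bT h] := cfc_conv_integral => e0.
have [d d0 hd] := h e e0; exists d => // n s xi sP sd.
have sS : self_adjoint (riemann n s xi fc).
  apply: (@sa_sum _ _ _ (fun i => (s i.+1 - s i)%:C *: fc (xi i))) => i ni.
  have [h0 h1 h2 h3] := tagged_partition_bounds sP ni.
  by apply/saZ/cfc_conv_sa; rewrite (le_trans h0 h1) (le_trans h2 h3).
split=> //; rewrite -opprB; apply: bndN.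
have bS : bounded_operator (riemann n s xi fc - integral).
  by apply: boundedB => //; case: sS.
apply: bnd_le (op_norm_ub bS); apply: ltW.
by have [s0 s1 sxi] := sP; exact: hd.
Qed.

Lemma grid_mesh (d : R) : 0 < d -> exists K, forall n, (K <= n)%N -> (0 < n)%N ->
  forall i, i.+1%:R / n%:R - i%:R / n%:R < d.
Proof.
move=> d0; exists (Num.truncn d^-1).+1 => n Kn n0 i.
rewrite -mulrBl -natr1 addrAC subrr add0r mul1r.
rewrite -[ltRHS]invrK ltf_pV2 ?posrE ?ltr0n ?invr_gt0 //.
by rewrite (lt_le_trans (truncnS_gt _)) // ler_nat.
Qed.

Lemma midpoint_partition n : (0 < n)%N -> @tagged_partition R n
  (fun i => i%:R / n%:R) (fun i => (2 * i + 1)%:R / (2 * n)%:R).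
Proof.
move=> n0; have n1 : (0 : R) < n%:R by rewrite ltr0n.
have [s0 s1 _] := @uniform_partition R n n0; split=> // i _.
have -> : (2 * i + 1)%:R / (2 * n)%:R = (i%:R + 1 / 2) / n%:R :> R.
  by rewrite addn1 -natr1 !natrM; field; rewrite gt_eqF.
rewrite !ler_pM2r ?invr_gt0 // -[i.+1%:R]natr1.
by apply/andP; split; lra.
Qed.

(** A norm limit of self-adjoint Riemann sums; this makes the form of the integral real, as [op_le]
    demands. *)
Lemma integral_sa : self_adjoint integral.
Proof.
have [_ bT _] := cfc_conv_integral; split=> //.
apply: adjoint_closed => e /integral_riemann[d d0 hd].
have [K hK] := grid_mesh d0.
have := hd K.+1 _ _ (uniform_partition _) (fun i _ => hK K.+1 (leqnSn K) isT i).
move=> /(_ isT)[[_ aS] TS].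
by exists (riemann K.+1 (fun i => i%:R / K.+1%:R) (fun i => i%:R / K.+1%:R) fc);
  exists (riemann K.+1 (fun i => i%:R / K.+1%:R) (fun i => i%:R / K.+1%:R) fc).
Qed.

Lemma midpoint_limit x (e : R) : 0 < e -> exists K, forall n, (K <= n)%N ->
  (0 < n)%N -> `|ri (integral x) x - midpoint_sum (phi x) n / n%:R| <= e.
Proof.
move=> e0; have c0 : 0 < nrm x ^+ 2 + 1 by rewrite ltr_wpDl ?sqr_ge0.
have [d d0 hd] := integral_riemann (divr_gt0 e0 c0).
have [K hK] := grid_mesh d0; exists K => n Kn n0.
have [_ /(_ x)] := hd n _ _ (midpoint_partition n0) (fun i _ => hK n Kn n0 i).
set S := riemann _ _ _ _ => hS.
have <- : ri (S x) x = midpoint_sum (phi x) n / n%:R.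
  rewrite /S /riemann (ri_sum _ (fun i => (i.+1%:R / n%:R - i%:R / n%:R)%:C *:
    fc ((2 * i + 1)%:R / (2 * n)%:R))) /midpoint_sum mulr_suml.
  apply: eq_bigr => i _; rewrite fctE riZl -mulrBl -natr1 addrAC subrr add0r.
  by rewrite mul1r mulrC.
rewrite -riBl (le_trans (cauchy_schwarz_abs _ _)) //.
rewrite (le_trans (ler_wpM2r (nrm_ge0 x) hS)) // -mulrA -expr2.
by rewrite mulrAC ler_pdivrMr // ler_pM2l // lerDl.
Qed.

Lemma midpoint_integral x N : (0 < N)%N ->
  midpoint_sum (phi x) N / N%:R <= ri (integral x) x.
Proof.
move=> N0; apply/ler_addgt0Pr => e /(midpoint_limit x)[K hK].
(* A multiple of [N] beyond the threshold [K]: the fine grid both refines the coarse one and is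
   close to the integral. *)
have NK : (K <= N * K.+1)%N by rewrite (leq_trans (leqnSn K)) // leq_pmull.
have := hK (N * K.+1)%N NK; rewrite muln_gt0 N0 => /(_ isT) h.
have N1 : (0 : R) < N%:R by rewrite ltr0n.
have K1 : (0 : R) < K.+1%:R by rewrite ltr0n.
rewrite (@le_trans _ _ (midpoint_sum (phi x) (N * K.+1) / (N * K.+1)%:R)) //.
  rewrite natrM invfM mulrA ler_pdivlMr // mulrAC ler_pM2r ?invr_gt0 // mulrC.
  exact: midpoint_refine_ge (cfc_conv_convex x) _.
by move: h; rewrite ler_norml lerBrDl => /andP[+ _]; rewrite lerBlDr.
Qed.

Lemma integral_trapezoid x N : (0 < N)%N ->
  ri (integral x) x <= trapezoid_sum (phi x) N / (2 * N%:R).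
Proof.
move=> N0; apply/ler_addgt0Pr => e /(midpoint_limit x)[K hK].
have NK : (K <= N * K.+1)%N by rewrite (leq_trans (leqnSn K)) // leq_pmull.
have := hK (N * K.+1)%N NK; rewrite muln_gt0 N0 => /(_ isT).
rewrite ler_norml => /andP[_ h].
have N1 : (0 : R) < N%:R by rewrite ltr0n.
have K1 : (0 : R) < K.+1%:R by rewrite ltr0n.
rewrite lerBlDl in h; apply: le_trans h _; rewrite lerD2r.
rewrite natrM !invfM !mulrA ler_pdivrMr // mulrAC ler_pM2r ?invr_gt0 // mulrC.
exact: midpoint_refine_le (cfc_conv_convex x) _.
Qed.

End HermiteHadamard.

Theorem theorem4p1 (R : realType) (H : hilbertType R) (A B : H -> H)
    (J : set R) (f : R -> R) (k p : nat) (A_sa : self_adjoint A)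
    (B_sa : self_adjoint B) (J_itv : is_interval J)
    (A_J : spectrum_in A J) (B_J : spectrum_in B J)
    (f_cont : {within J, continuous f}) (f_conv : operator_convex J f)
    (k_gt0 : (0 < k)%N) (p_gt0 : (0 < p)%N) :
  let N := (k ^ p)%N in
  let fc (t : R) := cfc f (op_conv t A B) in
  let midsum := (1 / N%:R : R)%:C *:
    \sum_(0 <= i < N) fc ((2 * i + 1)%:R / (2 * N)%:R) in
  let integral := op_integral 0 1 fc in
  let trapsum := (1 / (2 * N)%:R : R)%:C *:
    \sum_(0 <= i < N) (fc ((i + 1)%:R / N%:R) + fc (i%:R / N%:R)) in
  [/\ op_le (cfc f ((1 / 2 : R)%:C *: (A + B))) midsum,
      op_le midsum integral,
      op_le integral trapsum
    & op_le trapsum ((1 / 2 : R)%:C *: (cfc f A + cfc f B))].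
Proof.
move=> N fc midsum integral trapsum.
(* On the zero space all forms vanish, so any two operators are comparable; otherwise the spectra
   are nonempty and provide points of [J]. *)
have [x1|triv] := pselect (exists x : H, x != 0); last first.
  have h (S T : H -> H) : op_le S T.
    move=> x; have -> : x = 0 by apply: contrapT => /eqP x0; apply: triv; exists x.
    by rewrite innerC inner0l rmorph0.
  by split; exact: h.
have N0 : (0 < N)%N by rewrite expn_gt0 k_gt0.
have N1 : (0 : R) < N%:R by rewrite ltr0n.
have fcsa := cfc_conv_sa A_sa B_sa J_itv A_J B_J f_cont x1.
have cvx := cfc_conv_convex A_sa B_sa J_itv A_J B_J f_conv x1.
have isa : self_adjoint integral := integral_sa A_sa B_sa J_itv A_J B_J f_cont x1.
have fcA : cfc f A = fc 1 by rewrite /fc op_conv1.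
have fcB : cfc f B = fc 0 by rewrite /fc op_conv0.
have h01 : 0 <= (0 : R) <= 1 by rewrite lexx ler01.
have h11 : 0 <= (1 : R) <= 1 by rewrite lexx ler01.
have h21 : 0 <= (1 / 2 : R) <= 1 by apply/andP; split; lra.
have msa : self_adjoint midsum.
  rewrite /midsum big_mkord; apply/saZ.
  apply: (@sa_sum _ _ _ (fun i => fc ((2 * i + 1)%:R / (2 * N)%:R))) => i iN.
  exact/fcsa/(midpoint_unit (Ordinal iN)).
have tsa : self_adjoint trapsum.
  rewrite /trapsum big_mkord; apply/saZ.
  apply: (@sa_sum _ _ _ (fun i => fc ((i + 1)%:R / N%:R) + fc (i%:R / N%:R))) => i iN.
  by rewrite addn1; apply: saD; apply/fcsa/grid_unit => //; exact: ltnW.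
have esa : self_adjoint ((1 / 2 : R)%:C *: (cfc f A + cfc f B)).
  by rewrite fcA fcB; apply/saZ/saD; exact: fcsa.
have hsa : self_adjoint (cfc f ((1 / 2 : R)%:C *: (A + B))).
  by rewrite -op_conv_half; exact: fcsa.
have mE x : ri (midsum x) x = midpoint_sum (fun t => ri (fc t x) x) N / N%:R.
  rewrite /midsum big_mkord fctE riZl div1r mulrC; congr (_ / _).
  exact: (ri_sum _ (fun i => fc ((2 * i + 1)%:R / (2 * N)%:R))).
have tE x : ri (trapsum x) x =
    trapezoid_sum (fun t => ri (fc t x) x) N / (2 * N%:R).
  rewrite /trapsum big_mkord fctE riZl div1r mulrC natrM; congr (_ / _).
  rewrite (ri_sum _ (fun i => fc ((i + 1)%:R / N%:R) + fc (i%:R / N%:R))).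
  by apply: eq_bigr => i _; rewrite fctE riDl addn1.
split; apply: op_leP => // x.
- rewrite mE ler_pdivlMr // mulrC -op_conv_half.
  exact: midpoint_ge (cvx x).
- rewrite mE; exact: (midpoint_integral A_sa B_sa J_itv A_J B_J f_cont f_conv x1).
- rewrite tE; exact: (integral_trapezoid A_sa B_sa J_itv A_J B_J f_cont f_conv x1).
- rewrite tE ler_pdivrMr ?mulr_gt0 // fcA fcB !fctE riZl riDl.
  have -> : 1 / 2 * (ri (fc 1 x) x + ri (fc 0 x) x) * (2 * N%:R) =
    N%:R * (ri (fc 1 x) x + ri (fc 0 x) x) by field.
  exact: trapezoid_le (cvx x).
Qed.
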